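(* Let $\Sigma$ be a closed, connected, smooth $(n-1)$-manifold, and let $f=(f_1,\dots,f_{n-1}):\Sigma\to B^{n-1}$ be a Lagrangian immersion with respect to the standard symplectic form $\omega_0$ of $\mathbb{C}^{n-1}$. Let $\tau=-\sum_{i=1}^{n-1}(x_i\,dy_i-y_i\,dx_i)$, a $1$-form on $B^{n-1}$. Suppose that (1) $\int_{f(\gamma)}\tau\in2\pi\mathbb{Z}$ for all $\gamma\in H_1(\Sigma;\mathbb{Z})$, and (2) for all distinct points $x_1,\dots,x_k\in\Sigma$ such that $f(x_1)=f(x_j)$ for all $j\le k$, and a choice of path $\gamma_j$ in $\Sigma$ from $x_1$ to $x_j$ for $2\le j\le k$, the set $\left\{\left(\int_{f(\gamma_j)}\tau\right)\bmod 2\pi \;:\; 2\le j\le k\right\}$ has $k-1$ distinct values, none of which equals $0$. Then $\Sigma$ lifts to an embedded Legendrian submanifold $\tilde\Sigma\subset S^{2n-1}$ whose associated cone $c\tilde\Sigma$ is Lagrangian in $\mathbb{C}^n$. The lift $\tilde f:\Sigma\to S^{2n-1}\subset\mathbb{C}^n$ is given by $$\tilde f(x)=e^{it(x)}\left(f_1(x),\dots,f_{n-1}(x),\sqrt{1-|f(x)|^2}\right),\qquad t(x)=\int_{f(\gamma)}\tau,$$ for some path $\gamma$ in $\Sigma$ from a fixed initial point $x_0\in\Sigma$ to $x$.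
   Context: $B^{n-1}$ is the open unit ball in $\mathbb{C}^{n-1}$, with coordinates $z_i=x_i+iy_i$, and $\omega_0=\sum dx_i\wedge dy_i$. The sphere $S^{2n-1}\subset\mathbb{C}^n$ carries the standard contact form, the restriction of $\frac12\sum_{i=1}^n(x_i\,dy_i-y_i\,dx_i)$. The cone $c\tilde\Sigma$ is $\{rp: r>0,\ p\in\tilde\Sigma\}\subset\mathbb{C}^n$, and $\mathbb{C}^n$ carries its standard symplectic form $\sum_{i=1}^n dx_i\wedge dy_i$. *)

(* Defs.v *)
From HB Require Import structures.
From mathcomp Require Import all_boot all_order all_algebra.
From mathcomp Require Import all_classical all_reals all_analysis.

Set Implicit Arguments.
Unset Strict Implicit.
Unset Printing Implicit Defensive.

Import Order.TTheory GRing.Theory Num.Theory.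
Import numFieldNormedType.Exports.

Local Open Scope classical_set_scope.
Local Open Scope ring_scope.

(* Meant for open U and finite-dimensional V, where it is the usual class C^k. *)
Fixpoint Ck_on (R : realType) (V W : normedModType R) (k : nat) (U : set V)
    (f : V -> W) : Prop :=
  if k is k'.+1 then
    (forall p, U p -> differentiable f p) /\
    (forall v, Ck_on k' U (fun p => 'd f p v))
  else forall p, U p -> {for p, continuous f}.

Definition smooth_on (R : realType) (V W : normedModType R) (U : set V)
    (f : V -> W) : Prop := forall k, Ck_on k U f.

(* The functions are total; only crd on dom and par on crd @` dom matter. *)
Record chart (R : realType) (m : nat) (T : topologicalType) := Chart {
  dom : set T;
  crd : T -> 'rV[R]_m;
  par : 'rV[R]_m -> T;
  dom_open : open dom;
  crd_open : open (crd @` dom);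
  crdK : forall x, dom x -> par (crd x) = x;
  crd_cont : forall x, dom x -> {for x, continuous crd};
  par_cont : forall p, (crd @` dom) p -> {for p, continuous par} }.

Section Manifold.
Variables (R : realType) (m : nat) (T : topologicalType).
Variable A : set (chart R m T).

Definition smooth_atlas : Prop :=
  (forall x : T, exists2 c, A c & dom c x) /\
  (forall c c', A c -> A c' ->
    smooth_on (crd c @` (dom c `&` dom c')) (crd c' \o par c)).

(* "Closed" means compact without boundary. *)
Definition closed_manifold : Prop :=
  [/\ smooth_atlas, hausdorff_space T, second_countable (T := T)
    & compact [set: T]].

Definition smooth_map (W : normedModType R) (f : T -> W) : Prop :=
  forall c, A c -> smooth_on (crd c @` dom c) (f \o par c).

Definition immersion (W : normedModType R) (f : T -> W) : Prop :=
  smooth_map f /\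
  (forall c p, A c -> (crd c @` dom c) p -> injective ('d (f \o par c) p)).

Definition smooth_embedding (W : normedModType R) (f : T -> W) : Prop :=
  [/\ immersion f, injective f
    & forall O, open O -> exists2 U, open U & f @` O = range f `&` U].

Definition smooth_into (O : set R) (g : R -> T) : Prop :=
  (forall s, O s -> {for s, continuous g}) /\
  (forall c, A c -> smooth_on (O `&` g @^-1` dom c) (crd c \o g)).

(* Smooth arcs [0, 1] -> T; smoothness at the end points means that the arc
   extends smoothly to a neighbourhood of [0, 1]. *)
Definition smooth_arc (g : R -> T) : Prop :=
  exists O : set R, [/\ open O, `[0, 1]%classic `<=` O & smooth_into O g].

(* A path is a piecewise smooth one, given as the list of its smooth pieces,
   each parametrised by [0, 1]. *)
Fixpoint path_from_to (x : T) (s : seq (R -> T)) (y : T) : Prop :=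
  if s is g :: s' then [/\ smooth_arc g, g 0 = x & path_from_to (g 1) s' y]
  else x = y.

(* The chain sum_j a_j g_j is a smooth singular 1-cycle: every point has
   coefficient zero in its boundary.  Every class in H_1(T; Z) is represented by
   such cycles, and a closed 1-form has the same integral over all of them. *)
Definition smooth_cycle (N : nat) (a : 'I_N -> int) (g : 'I_N -> R -> T) : Prop :=
  (forall j, smooth_arc (g j)) /\
  (forall p : T, \sum_j a j * ((g j 1 == p)%:R - (g j 0 == p)%:R) = 0).

End Manifold.

(* C^n in the real coordinates z = (x, y) for z_i = x_i + i y_i. *)
Notation cplx R n := ('rV[R]_n * 'rV[R]_n)%type.

Section Forms.
Variables (R : realType) (n : nat).
Implicit Types z u v w : cplx R n.

Definition normsq z : R := \sum_i (z.1 ord0 i ^+ 2 + z.2 ord0 i ^+ 2).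

Definition unit_ball : set (cplx R n) := [set z | normsq z < 1].

Definition unit_sphere : set (cplx R n) := [set z | normsq z = 1].

(* sum_i dx_i /\ dy_i *)
Definition omega u v : R :=
  \sum_i (u.1 ord0 i * v.2 ord0 i - u.2 ord0 i * v.1 ord0 i).

(* The 1-form sum_i (x_i dy_i - y_i dx_i), at z, on the tangent vector w. *)
Definition lambda z w : R :=
  \sum_i (z.1 ord0 i * w.2 ord0 i - z.2 ord0 i * w.1 ord0 i).

Definition tau z w : R := - lambda z w.

Definition contact_form z w : R := 2^-1 * lambda z w.

(* Multiplication by e^(it). *)
Definition rot (t : R) z : cplx R n :=
  (cos t *: z.1 - sin t *: z.2, sin t *: z.1 + cos t *: z.2).

Definition int_tau (c : R -> cplx R n) : R :=
  \int[lebesgue_measure]_(s in `[0, 1]) tau (c s) (derive1 c s).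

Definition cone (S : set (cplx R n)) : set (cplx R n) :=
  [set z | exists r p, [/\ 0 < r, S p & z = r *: p]].

End Forms.

Section Submanifold.
Variables (R : realType) (W : normedModType R).

(* S is locally the homeomorphic image of an open set of R^k under a smooth
   immersion. *)
Definition embedded_submanifold (k : nat) (S : set W) : Prop :=
  forall q, S q -> exists (V : set 'rV[R]_k) (psi : 'rV[R]_k -> W),
    [/\ open V, smooth_on V psi, (psi @` V) q &
      [/\ forall p, V p -> injective ('d psi p),
          {in V &, injective psi}
        & forall V', open V' -> V' `<=` V ->
            exists2 U, open U & psi @` V' = S `&` U]].

(* Velocities at q of smooth curves lying in S. *)
Definition tangent_vector (S : set W) (q w : W) : Prop :=
  exists (O : set R) (c : R -> W),
    [/\ open O, O 0, smooth_on O c &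
      [/\ forall s, O s -> S (c s), c 0 = q & derive1 c 0 = w]].

End Submanifold.

Definition lagrangian_immersion (R : realType) (m : nat) (T : topologicalType)
    (A : set (chart R m T)) (f : T -> cplx R m) : Prop :=
  immersion A f /\
  (forall c p u v, A c -> (crd c @` dom c) p ->
    omega ('d (f \o par c) p u) ('d (f \o par c) p v) = 0).

Definition lagrangian_submanifold (R : realType) (n : nat)
    (S : set (cplx R n)) : Prop :=
  embedded_submanifold n S /\
  (forall q u v, S q -> tangent_vector S q u -> tangent_vector S q v ->
    omega u v = 0).

(* Here n = m + 1, so that the sphere has dimension 2 n - 1 = 2 m + 1. *)
Definition legendrian_submanifold (R : realType) (m : nat)
    (L : set (cplx R (m + 1))) : Prop :=
  [/\ L `<=` @unit_sphere R (m + 1), embedded_submanifold m L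
    & forall q w, L q -> tangent_vector L q w -> contact_form q w = 0].

Section Lift.
Variables (R : realType) (m : nat) (T : topologicalType).
Implicit Types (f : T -> cplx R m) (A : set (chart R m T)).

Definition int_tau_path f (s : seq (R -> T)) : R :=
  \sum_(g <- s) int_tau (f \o g).

Definition int_tau_chain f (N : nat) (a : 'I_N -> int) (g : 'I_N -> R -> T) : R :=
  \sum_j (a j)%:~R * int_tau (f \o g j).

(* t x is the integral of tau along the f-image of some path from x0 to x. *)
Definition path_phase A f (x0 : T) (t : T -> R) : Prop :=
  forall x, exists2 s, path_from_to A x0 s x & t x = int_tau_path f s.

Definition lift_of f (t : T -> R) (x : T) : cplx R (m + 1) :=
  rot (t x) (row_mx (f x).1 (const_mx (Num.sqrt (1 - normsq (f x)))),
             row_mx (f x).2 0).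

End Lift.

(* The representative in [0, 2 pi) of r mod 2 pi. *)
Definition mod_2pi (R : realType) (r : R) : R :=
  r - (2 * pi) * (Num.floor (r / (2 * pi)))%:~R.

(* Main.v *)
Require Import Defs.
From HB Require Import structures.
From mathcomp Require Import all_boot all_order all_algebra.
From mathcomp Require Import all_classical all_reals all_analysis.
From mathcomp Require Import ring lra.

Set Implicit Arguments.
Unset Strict Implicit.
Unset Printing Implicit Defensive.

Import Order.TTheory GRing.Theory Num.Theory.
Import numFieldNormedType.Exports.

Local Open Scope classical_set_scope.
Local Open Scope ring_scope.
(** The form [tau] satisfies [d tau = - 2 omega], so its pullback along a
    Lagrangian immersion is closed and has a smooth primitive in every coordinate
    ball ([pullback_tau_closed], [is_diff_directional]). The phase [t] agrees with
    this primitive up to a multiple of [2 pi], because the periods of [tau] are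
    such multiples ([local_phase]). Hence [e^(it)] is smooth and independent of
    the paths chosen, although [t] itself may jump.

    Write the lift as [e^(it) b] with [b = (f, sqrt (1 - |f|^2))]. As [|b| = 1]
    and the last coordinate of [b] is real, the form [sum x dy - y dx] takes on a
    velocity of the lift the value [dt - tau], which is zero: the lift is
    horizontal, that is Legendrian, and [omega] restricted to it reduces to the
    pullback of [omega] by [f] ([lift_legendrian], [lift_isotropic]). The last
    coordinate of [b] is positive, so a zero velocity of the lift forces [dt] and
    then [df] to vanish, and the lift is an immersion ([lift_immersive]). A point
    of the lift determines [f] and [e^(it)]; the condition at double points of [f]
    says exactly that these separate points, and compactness turns injectivity
    into an embedding ([lift_injective], [lift_open_image]).

    In the cone, [omega] vanishes between the radial direction and a velocity of
    the lift by the Legendrian condition, and between two such velocities by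
    isotropy ([cone_chart_isotropic]). Tangent vectors are velocities of
    arbitrary smooth curves contained in a set. Such a curve is not known in
    advance to have smooth coordinates, and [tangent_vector_closure] shows that
    its velocity is a limit of velocities of a parametrisation; this is enough,
    since the vanishing of a continuous form passes to limits. *)

(** * Differentials and the classes C^k *)

Section Differentials.
Context {R : realType}.
Implicit Types V W : normedModType R.

Lemma is_diff_epsP V W (f : V -> W) (L : {linear V -> W}) (p : V) :
  continuous L ->
  is_diff p f L <->
  (forall e, 0 < e -> \forall h \near 0, `|f (h + p) - f p - L h| <= e * `|h|).
Proof.
move=> cL; split=> [df e e0|H].
  have /diff_locally := @ex_diff _ _ _ _ _ _ _ df.
  rewrite (@diff_val _ _ _ _ _ _ _ df) => /eqaddoP /(_ _ e0).
  by apply: filterS => h; rewrite !fctE /= opprD addrA.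
have E : f \o shift p = cst (f p) + L +o_ 0 id.
  apply/eqaddoP => e e0; move: (H e e0).
  by apply: filterS => h; rewrite !fctE /= opprD addrA.
have dE := diff_unique cL E.
split=> //; apply/diff_locallyP; rewrite dE; split=> //.
Qed.

Lemma is_diff_near V W (f g : V -> W) (p : V) df :
  (\forall q \near p, f q = g q) -> is_diff p f df -> is_diff p g df.
Proof.
move=> fg [dfp <-].
have cL : continuous ('d f p) by exact: diff_continuous.
apply/(is_diff_epsP g p cL) => e e0.
have /(is_diff_epsP f p cL) /(_ e e0) := differentiableP dfp.
have fgp : f p = g p by exact: (nbhs_singleton fg).
have : \forall h \near 0, f (h + p) = g (h + p).
  by move: fg; rewrite [X in X -> _](near_shift 0 p) /= subr0; apply: filterS.
by apply: filterS2 => h ->; rewrite fgp.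
Unshelve. all: by end_near. Qed.

Lemma is_diff_ext V W (f g : V -> W) (p : V) df dg :
  f =1 g -> df =1 dg -> is_diff p f df -> is_diff p g dg.
Proof. by move=> /funext -> /funext ->. Qed.

Lemma is_diffE V W (f : V -> W) (p : V) df : is_diff p f df -> 'd f p =1 df.
Proof. by move=> [_ ->]. Qed.

Lemma is_diff_differentiable V W (f : V -> W) (p : V) df :
  is_diff p f df -> differentiable f p.
Proof. by case. Qed.

Lemma is_diff_linear V W (L : {linear V -> W}) p : continuous L -> is_diff p L L.
Proof.
by move=> cL; split; [exact: linear_differentiable|exact: diff_lin].
Qed.

Lemma is_diff_lincomp V W W' (L : {linear W -> W'}) (f : V -> W) p df :
  continuous L -> is_diff p f df -> is_diff p (fun q => L (f q)) (fun v => L (df v)).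
Proof.
move=> cL dfp; have dL := is_diff_linear (f p) cL.
exact: (@is_diff_comp _ _ _ _ _ _ _ _ _ dfp dL).
Qed.

Lemma is_diff_bilin V W1 W2 W3 (B : {bilinear W1 -> W2 -> W3})
    (f : V -> W1) (g : V -> W2) p df dg :
  continuous (fun z => B z.1 z.2) -> is_diff p f df -> is_diff p g dg ->
  is_diff p (fun q => B (f q) (g q)) (fun v => B (f p) (dg v) + B (df v) (g p)).
Proof.
move=> cB dfp dgp.
have dB : is_diff (f p, g p) (fun z => B z.1 z.2)
    (fun z => B (f p) z.2 + B z.1 (g p)).
  by split; [exact: differentiable_bilin|rewrite diff_bilin].
have dfg := is_diff_pair dfp dgp.
exact: (@is_diff_comp _ _ _ _ _ _ _ _ _ dfg dB).
Qed.

Lemma scale_bilinear V :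
  bilinear_for
    (GRing.Scale.Law.clone _ _ *:%R _) (GRing.Scale.Law.clone _ _ *:%R _)
    (@GRing.scale R V : R^o -> V -> V).
Proof.
split=> [u a x y|u a x y] /=; first by rewrite scalerDl scalerA.
by rewrite scalerDr !scalerA mulrC.
Qed.

HB.instance Definition _ V :=
  bilinear_isBilinear.Build R R^o V V _ _ (@GRing.scale R V) (@scale_bilinear V).

Lemma is_diff_scale V W (k : V -> R) (f : V -> W) p dk df :
  is_diff p k dk -> is_diff p f df ->
  is_diff p (fun q => k q *: f q) (fun v => k p *: df v + dk v *: f p).
Proof.
move=> dkp dfp.
have cS : continuous (fun z : R^o * W => z.1 *: z.2).
  exact: scale_continuous.
exact: (@is_diff_bilin _ _ _ _ (@GRing.scale R W : {bilinear R^o -> W -> W}) _ _ _ _ _ cS dkp dfp).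
Qed.

End Differentials.

Section CkCalculus.
Context {R : realType}.
Implicit Types V W : normedModType R.

Lemma Ck_on_sub V W k (U U' : set V) (f : V -> W) :
  U `<=` U' -> Ck_on k U' f -> Ck_on k U f.
Proof.
move=> UU'; elim: k f => [|k IH] f /=; first by move=> H p /UU'/H.
by move=> [H1 H2]; split=> [p /UU'/H1//|v]; exact/IH/H2.
Qed.

Lemma Ck_on_local V W k (U : set V) (f : V -> W) :
  (forall p, U p -> exists2 O, O p & Ck_on k O f) -> Ck_on k U f.
Proof.
elim: k f => [|k IH] f /= H; first by move=> p /H[Q Qp]; apply.
split=> [p /H[Q Qp [+ _]]|v]; first by apply.
by apply: IH => p /H[Q Qp [_ /(_ v)]]; exists Q.
Qed.

Lemma Ck_onW V W k (U : set V) (f : V -> W) : Ck_on k.+1 U f -> Ck_on k U f.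
Proof.
elim: k f => [|k IH] f [df H]; first by move=> p Up; exact/differentiable_continuous/df.
by split=> // v; exact/IH/H.
Qed.

Lemma Ck_on_eq V W k (U : set V) (f g : V -> W) : open U ->
  (forall p, U p -> f p = g p) -> Ck_on k U f -> Ck_on k U g.
Proof.
move=> oU; elim: k f g => [|k IH] f g fg /=.
  move=> H p Up; have gp : g @ p --> f p.
    apply: cvg_trans (H p Up); apply: near_eq_cvg.
    by apply: filterS (open_nbhs_nbhs (conj oU Up)) => q /fg.
  by rewrite fg in gp.
move=> [df H].
have dg p : U p -> is_diff p g ('d f p).
  move=> Up; apply: (is_diff_near _ (differentiableP (df p Up))).
  by apply: filterS (open_nbhs_nbhs (conj oU Up)) => q /fg.
split=> [p /dg /is_diff_differentiable//|v].
by apply: IH (H v) => p Up; rewrite (is_diffE (dg p Up)).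
Qed.

(** The derivative may be given by any formula valid on [U], because only its
    restriction to the open set [U] matters. *)
Lemma Ck_onS V W k (U : set V) (f : V -> W) (df : V -> V -> W) : open U ->
  (forall p, U p -> is_diff p f (df p)) ->
  (forall v, Ck_on k U (df ^~ v)) -> Ck_on k.+1 U f.
Proof.
move=> oU dfE H; split=> [p /dfE /is_diff_differentiable//|v].
by apply: Ck_on_eq (H v) => // p Up; rewrite (is_diffE (dfE p Up)).
Qed.

Lemma Ck_on_is_diff V W k (U : set V) (f : V -> W) p :
  Ck_on k.+1 U f -> U p -> is_diff p f ('d f p).
Proof. by move=> [df _] /df/differentiableP. Qed.

Lemma Ck_on_d V W k (U : set V) (f : V -> W) v :
  Ck_on k.+1 U f -> Ck_on k U (fun p => 'd f p v).
Proof. by move=> [_]; apply. Qed.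

Lemma Ck_on_cst V W k (U : set V) (a : W) : open U -> Ck_on k U (cst a).
Proof.
move=> oU; elim: k a => [|k IH] a; first by move=> p _; exact: cst_continuous.
apply: (@Ck_onS _ _ _ _ _ (fun _ _ => 0)) => // v.
exact: (IH 0).
Qed.

Lemma Ck_on_linear V W k (U : set V) (L : {linear V -> W}) : open U ->
  continuous L -> Ck_on k U L.
Proof.
move=> oU cL; case: k => [|k]; first by move=> p _; exact: cL.
apply: (@Ck_onS _ _ _ _ _ (fun _ => L)) => // [p _|v].
  exact: is_diff_linear.
exact: Ck_on_cst.
Qed.

Lemma Ck_onD V W k (U : set V) (f g : V -> W) : open U ->
  Ck_on k U f -> Ck_on k U g -> Ck_on k U (fun p => f p + g p).
Proof.
move=> oU; elim: k f g => [|k IH] f g Hf Hg.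
  by move=> p Up; apply: cvgD; [exact: Hf|exact: Hg].
apply: (@Ck_onS _ _ _ _ _ (fun p v => 'd f p v + 'd g p v)) => // [p Up|v].
  exact: is_diffD (Ck_on_is_diff Hf Up) (Ck_on_is_diff Hg Up).
by apply: IH; [exact: Ck_on_d Hf|exact: Ck_on_d Hg].
Qed.

Lemma Ck_on_lincomp V W W' k (U : set V) (L : {linear W -> W'}) (f : V -> W) :
  open U -> continuous L -> Ck_on k U f -> Ck_on k U (fun p => L (f p)).
Proof.
move=> oU cL; elim: k f => [|k IH] f Hf.
  by move=> p Up; apply: continuous_comp; [exact: Hf|exact: cL].
apply: (@Ck_onS _ _ _ _ _ (fun p v => L ('d f p v))) => // [p Up|v].
  exact: is_diff_lincomp (Ck_on_is_diff Hf Up).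
exact/IH/Ck_on_d.
Qed.

Lemma Ck_on_bilin V W1 W2 W3 (B : {bilinear W1 -> W2 -> W3}) k (U : set V)
    (f : V -> W1) (g : V -> W2) : open U -> continuous (fun z => B z.1 z.2) ->
  Ck_on k U f -> Ck_on k U g -> Ck_on k U (fun p => B (f p) (g p)).
Proof.
move=> oU cB; elim: k f g => [|k IH] f g Hf Hg.
  move=> p Up.
  apply: (@continuous_comp _ _ _ (fun q => (f q, g q)) (fun z => B z.1 z.2)).
    by apply: cvg_pair; [exact: Hf|exact: Hg].
  exact: cB.
apply: (@Ck_onS _ _ _ _ _ (fun p v => B (f p) ('d g p v) + B ('d f p v) (g p)))
  => // [p Up|v].
  exact: is_diff_bilin (Ck_on_is_diff Hf Up) (Ck_on_is_diff Hg Up).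
apply: Ck_onD => //; apply: IH.
- exact: Ck_onW.
- exact: Ck_on_d Hg.
- exact: Ck_on_d Hf.
- exact: Ck_onW.
Qed.

Lemma Ck_onZ V W k (U : set V) (c : V -> R) (f : V -> W) : open U ->
  Ck_on k U c -> Ck_on k U f -> Ck_on k U (fun p => c p *: f p).
Proof.
move=> oU Hc Hf.
apply: (@Ck_on_bilin _ _ _ _ (@GRing.scale R W : {bilinear R^o -> W -> W})) => //.
exact: scale_continuous.
Qed.

Lemma Ck_onM V k (U : set V) (f g : V -> R) : open U ->
  Ck_on k U f -> Ck_on k U g -> Ck_on k U (fun p => f p * g p).
Proof. exact: (@Ck_onZ V R^o). Qed.

Lemma Ck_onN V W k (U : set V) (f : V -> W) : open U ->
  Ck_on k U f -> Ck_on k U (fun p => - f p).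
Proof.
move=> oU Hf; apply: (@Ck_on_eq _ _ _ _ (fun p => (-1) *: f p)) => //.
  by move=> p _; rewrite scaleN1r.
exact: Ck_onZ (Ck_on_cst _ _ oU) _.
Qed.

Lemma Ck_on_sum V W k (U : set V) n (f : 'I_n -> V -> W) : open U ->
  (forall i, Ck_on k U (f i)) -> Ck_on k U (fun p => \sum_i f i p).
Proof.
move=> oU Hf; elim: n f Hf => [|n IH] f Hf.
  apply: Ck_on_eq (Ck_on_cst _ _ oU) => // p _; by rewrite big_ord0.
apply: (@Ck_on_eq _ _ _ _ (fun p => \sum_i f (lift ord_max i) p + f ord_max p)) => //.
  move=> p _; rewrite big_ord_recr /=; congr (_ + _).
  by apply: eq_bigr => i _; congr (f _ _); apply: val_inj; rewrite /= /bump leqNgt ltn_ord.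
by apply: Ck_onD => //; apply: IH => i; exact: Hf.
Qed.

(** For a substitution [b + L q] the derivative in the direction [v] is the same
    substitution into the derivative of [f] in the direction [L v], so that the
    induction on [k] needs no chain rule for higher derivatives. *)
Lemma Ck_on_affine V V' W k (U : set V) (U' : set V') (L : {linear V' -> V})
    (b : V) (f : V -> W) : open U' -> continuous L ->
  (forall q, U' q -> U (b + L q)) -> Ck_on k U f ->
  Ck_on k U' (fun q => f (b + L q)).
Proof.
move=> oU' cL UU'; elim: k f => [|k IH] f Hf.
  move=> q U'q; apply: (@continuous_comp _ _ _ (fun q => b + L q)).
    by apply: cvgD; [exact: cvg_cst|exact: cL].
  exact/Hf/UU'.
apply: (@Ck_onS _ _ _ _ _ (fun q v => 'd f (b + L q) (L v))) => // [q U'q|v].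
  have dL : is_diff q (fun q => b + L q) L.
    apply: is_diff_ext (is_diffD (is_diff_cst b q) (is_diff_linear q cL)) => //.
    by move=> v; rewrite !fctE add0r.
  exact: (@is_diff_comp _ _ _ _ _ _ _ _ _ dL (Ck_on_is_diff Hf (UU' q U'q))).
exact: (IH (fun p => 'd f p (L v)) (proj2 Hf (L v))).
Qed.

Lemma is_diff_comp1 V (h : R -> R) (dh : R) (f : V -> R) p df :
  is_derive (f p) 1 h dh -> is_diff p f df ->
  is_diff p (fun q => h (f q)) (fun v => df v * dh).
Proof.
move=> hp dfp.
have dh' : is_diff (f p) h (fun x => x * dh).
  have dv : derivable h (f p) 1 by [].
  split; first exact/derivable1_diffP.
  by rewrite deriv1E// derive1E derive_val.
exact: (@is_diff_comp _ _ _ _ _ _ _ _ _ dfp dh').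
Qed.

(** The derivative of each function is a multiple of the other one, whence the
    simultaneous induction. *)
Lemma Ck_on_cos_sin V k (U : set V) (f : V -> R) : open U -> Ck_on k U f ->
  Ck_on k U (fun p => cos (f p)) /\ Ck_on k U (fun p => sin (f p)).
Proof.
move=> oU; elim: k f => [|k IH] f Hf.
  split=> p Up; apply: continuous_comp;
    first [exact: Hf|exact: continuous_cos|exact: continuous_sin].
have [Hc Hs] := IH _ (Ck_onW Hf).
split.
  apply: (@Ck_onS _ _ _ _ _ (fun p v => 'd f p v * - sin (f p))) => // [p Up|v].
    exact: is_diff_comp1 (Ck_on_is_diff Hf Up).
  by apply: Ck_onM => //; [exact: Ck_on_d Hf|exact: Ck_onN].
apply: (@Ck_onS _ _ _ _ _ (fun p v => 'd f p v * cos (f p))) => // [p Up|v].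
  exact: is_diff_comp1 (Ck_on_is_diff Hf Up).
by apply: Ck_onM => //; exact: Ck_on_d Hf.
Qed.

Lemma Ck_onV V k (U : set V) (f : V -> R) : open U ->
  (forall p, U p -> f p != 0) -> Ck_on k U f -> Ck_on k U (fun p => (f p)^-1).
Proof.
move=> oU f0; elim: k f f0 => [|k IH] f f0 Hf.
  by move=> p Up; apply: cvgV; [exact: f0|exact: Hf].
apply: (@Ck_onS _ _ _ _ _ (fun p v => 'd f p v * - ((f p)^-1 * (f p)^-1)))
  => // [p Up|v].
  apply: is_diff_comp1 (Ck_on_is_diff Hf Up).
  split; first by apply: derivableV => //; exact: f0.
  by rewrite deriveV ?f0// derive_id scaler1 expr2 invfM.
have HV := IH _ f0 (Ck_onW Hf).
by apply: Ck_onM => //; [exact: Ck_on_d Hf|exact/Ck_onN/Ck_onM].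
Qed.

Lemma is_diff_sqrt V (f : V -> R) p df : 0 < f p -> is_diff p f df ->
  is_diff p (fun q => Num.sqrt (f q)) (fun v => df v * (2 * Num.sqrt (f p))^-1).
Proof. by move=> f0; apply: is_diff_comp1; exact: is_derive1_sqrt. Qed.

Lemma Ck_on_sqrt V k (U : set V) (f : V -> R) : open U ->
  (forall p, U p -> 0 < f p) -> Ck_on k U f ->
  Ck_on k U (fun p => Num.sqrt (f p)).
Proof.
move=> oU f0; elim: k f f0 => [|k IH] f f0 Hf.
  by move=> p Up; apply: continuous_comp; [exact: Hf|exact: sqrt_continuous].
apply: (@Ck_onS _ _ _ _ _ (fun p v => 'd f p v * (2 * Num.sqrt (f p))^-1))
  => // [p Up|v].
  by apply: is_diff_sqrt; [exact: f0|exact: Ck_on_is_diff Hf Up].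
apply: Ck_onM => //; first exact: Ck_on_d Hf.
apply: Ck_onV => //; first by move=> p Up; rewrite mulf_neq0// gt_eqF// sqrtr_gt0 f0.
apply: Ck_onM => //; first exact: Ck_on_cst.
exact/IH/Ck_onW.
Qed.

End CkCalculus.

(** * Symmetry of second derivatives *)

Section Lines.
Context {R : realType}.
Implicit Types V W : normedModType R.

Lemma is_diff_line V (p u : V) (x : R) :
  is_diff x (fun y : R => p + y *: u) (fun y => y *: u).
Proof.
apply: is_diff_ext (is_diffD (is_diff_cst p x) (is_diff_scalel x u)) => //.
by move=> v; rewrite !fctE add0r.
Qed.

Lemma is_derive_line V W (f : V -> W) p u (x : R) df :
  is_diff (p + x *: u) f df -> is_derive x 1 (fun y : R => f (p + y *: u)) (df u).
Proof.
move=> dfx; have dc := @is_diff_comp _ _ _ _ _ _ _ _ _ (is_diff_line p u x) dfx.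
have dc1 := is_diff_differentiable dc.
split; first exact: diff_derivable.
by rewrite deriveE// (is_diffE dc) /= scale1r.
Qed.

Lemma MVT_derive (f df : R -> R) (a b : R) : a < b ->
  (forall x, x \in `[a, b]%R -> is_derive x 1 f (df x)) ->
  exists2 c, c \in `]a, b[%R & f b - f a = df c * (b - a).
Proof.
move=> ab H; apply (@MVT R f df a b ab).
  by move=> x xab; apply: H; move: xab; rewrite !in_itv/= => /andP[/ltW-> /ltW->].
by apply: derivable_within_continuous => x xab; have [] := H x xab.
Qed.

(** The second difference of [f] in the directions [u] and [v]. It is symmetric
    in [u] and [v], and two applications of the mean value theorem compare it
    with the derivative in the direction [u] followed by that along [v]. *)
Let Delta V (f : V -> R) p u v (a : R) :=
  f (p + a *: v + a *: u) - f (p + a *: u) - (f (p + a *: v) - f p).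

Let DeltaC V (f : V -> R) p u v a : Delta f p u v a = Delta f p v u a.
Proof.
rewrite /Delta (addrAC p) -!addrA; congr (_ + _).
by rewrite !opprD !opprK !addrA (addrC (- f _)).
Qed.

Let Delta_cvg V (f : V -> R) (U : set V) p u v : open U -> U p -> Ck_on 2 U f ->
  forall e : R, 0 < e -> exists2 d : R, 0 < d & forall a : R, 0 < a -> a < d ->
    `|Delta f p u v a - 'd (fun q => 'd f q u) p v * a * a| <= e * a * a.
Proof.
move=> oU Up Hf e e0.
pose D2 q := 'd (fun q => 'd f q u) q v.
have cD2 : {for p, continuous D2}.
  by have := Ck_on_d v (Ck_on_d u Hf); exact.
have /nbhs_ballP[r /= r0 Hr] : \forall q \near p, U q /\ `|D2 q - D2 p| <= e.
  apply: filterI; first exact: open_nbhs_nbhs.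
  by move/cvgrPdist_le : cD2 => /(_ _ e0); apply: filterS => q; rewrite distrC.
(* [a * M] exceeds the length of [x *: u + y *: v] for [x] and [y] in [0, a]. *)
pose M := 1 + `|u| + `|v|.
have M0 : 0 < M by rewrite /M ltr_pwDl// ltr_pwDl.
exists (r / M); first exact: divr_gt0.
move=> a a0 ad.
have near_p x y : 0 <= x <= a -> 0 <= y <= a -> ball p r (p + x *: u + y *: v).
  move=> /andP[x0 xa] /andP[y0 ya]; rewrite -ball_normE /= -addrA opprD addrA subrr sub0r normrN.
  apply: (le_lt_trans (ler_normD _ _)); rewrite !normrZ !ger0_norm//.
  apply: (@le_lt_trans _ _ (a * M)); last by rewrite -ltr_pdivlMr.
  have : x * `|u| <= a * `|u| by rewrite ler_wpM2r.
  have : y * `|v| <= a * `|v| by rewrite ler_wpM2r.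
  by rewrite /M !mulrDr mulr1; lra.
have I0 x : x \in `[0, a]%R -> 0 <= x <= a by rewrite in_itv.
have Ioo x : x \in `]0, a[%R -> 0 <= x <= a by rewrite in_itv/= => /andP[/ltW-> /ltW->].
have a00 : (0 : R) <= 0 <= a by rewrite lexx ltW.
have aaa : 0 <= a <= a by apply/andP; split; [exact: ltW|exact: lexx].
have dfU q : U q -> is_diff q f ('d f q) by move=> Uq; exact: Ck_on_is_diff Hf Uq.
have dg x : x \in `[0, a]%R ->
    is_derive x 1 (fun x => f (p + a *: v + x *: u) - f (p + x *: u))
      ('d f (p + a *: v + x *: u) u - 'd f (p + x *: u) u).
  move=> /I0 xa; apply: is_deriveB.
    by apply/is_derive_line/dfU; rewrite addrAC; apply: (Hr _ (near_p _ _ xa aaa)).1.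
  apply/is_derive_line/dfU.
  by have := (Hr _ (near_p _ _ xa a00)).1; rewrite scale0r addr0.
have [c cI] := MVT_derive a0 dg.
rewrite !scale0r !addr0 subr0 => E1.
have dh y : y \in `[0, a]%R -> is_derive y 1
    (fun y => 'd f (p + c *: u + y *: v) u) (D2 (p + c *: u + y *: v)).
  move=> /I0 ya.
  have Uy := (Hr _ (near_p _ _ (Ioo _ cI) ya)).1.
  exact: (is_derive_line (Ck_on_is_diff (Ck_on_d u Hf) Uy)).
have [c' c'I] := MVT_derive a0 dh.
rewrite scale0r addr0 subr0 => E2.
rewrite /Delta E1 (addrAC p) E2 -!mulrBl !normrM (gtr0_norm a0).
rewrite !ler_pM2r//.
exact: (Hr _ (near_p _ _ (Ioo _ cI) (Ioo _ c'I))).2.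
Qed.

(** The same second difference, divided by [a ^+ 2], tends to both sides. *)
Lemma diff2C V (f : V -> R) (U : set V) p u v : open U -> U p -> Ck_on 2 U f ->
  'd (fun q => 'd f q u) p v = 'd (fun q => 'd f q v) p u.
Proof.
move=> oU Up Hf; apply/eqP; rewrite -subr_eq0 -normr_le0; apply/ler_addgt0Pl => /= e e0.
have e2 : 0 < e / 2 by rewrite divr_gt0.
have [d d0 H] := Delta_cvg u v oU Up Hf e2.
have [d' d'0 H'] := Delta_cvg v u oU Up Hf e2.
have m0 : 0 < Num.min d d' by rewrite lt_min d0.
have [a a0 am] : exists2 a : R, 0 < a & a < Num.min d d'.
  exists (Num.min d d' / 2); first by rewrite divr_gt0.
  by rewrite ltr_pdivrMr// mulr_natr mulr2n ltrDl.
move: am; rewrite lt_min => /andP[/(H _ a0) {}H /(H' _ a0) {}H'].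
rewrite DeltaC distrC in H.
have := le_trans (ler_normD _ _) (lerD H H').
rewrite subrKA -!mulrBl -2!mulrDl !normrM (gtr0_norm a0) !ler_pM2r//.
by rewrite -splitr addr0.
Qed.

End Lines.

(** * The Poincare lemma on a ball *)

Section Poincare.
Context {R : realType}.
Notation mu := (@lebesgue_measure R).

Lemma within_continuous (T U : topologicalType) (f : T -> U) (A : set T) :
  (forall x, A x -> {for x, continuous f}) -> {within A, continuous f}.
Proof. by move=> H; apply: continuous_in_subspaceT => x /set_mem; exact: H. Qed.

Lemma continuous_pairl (x s : R) : {for s, continuous (fun s : R => (x, s))}.
Proof. by apply/differentiable_continuous/differentiable_pair. Qed.

Lemma Rintegral_derive (F f : R -> R) :
  (forall s : R, s \in `[0, 1]%R -> is_derive s 1 F (f s)) ->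
  (forall s : R, s \in `[0, 1]%R -> {for s, continuous f}) ->
  \int[mu]_(s in `[0, 1]) f s = F 1 - F 0.
Proof.
move=> dF cf.
have cF (s : R) : s \in `[0, 1]%R -> {for s, continuous F}.
  by move=> /dF[+ _] => /derivable1_diffP/differentiable_continuous.
have i0 : (0 : R) \in `[0, 1]%R by rewrite in_itv/= lexx ler01.
have i1 : (1 : R) \in `[0, 1]%R by rewrite in_itv/= lexx ler01.
have oc (s : R) : s \in `]0, 1[%R -> s \in `[0, 1]%R.
  by rewrite !in_itv/= => /andP[/ltW-> /ltW->].
rewrite /Rintegral (@continuous_FTC2 _ f F 0 1)//.
- by apply: within_continuous => s; exact: cf.
- split=> [s /oc /dF[]//| |].
    by apply: cvg_at_right_filter; exact: cF.
  by apply: cvg_at_left_filter; exact: cF.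
- by move=> s /oc /dF [_ <-]; rewrite derive1E.
Qed.

Lemma ball_convex (V : normedModType R) (p0 p q : V) e (s : R) :
  ball p0 e p -> ball p0 e q -> s \in `[0, 1]%R -> ball p0 e (p + s *: (q - p)).
Proof.
rewrite -ball_normE /= => pe qe; rewrite in_itv/= => /andP[s0 s1].
have -> : p0 - (p + s *: (q - p)) = (1 - s) *: (p0 - p) + s *: (p0 - q).
  have -> : p0 - q = (p0 - p) - (q - p) by rewrite opprB addrA subrK.
  rewrite opprD addrA; move: (p0 - p) (q - p) => u v.
  by rewrite [s *: (u - v)]scalerBr addrA -scalerDl subrK scale1r.
apply: (le_lt_trans (ler_normD _ _)); rewrite !normrZ !ger0_norm ?subr_ge0//.
have [->|s1'] := eqVneq s 1; first by rewrite subrr mul0r add0r mul1r.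
have : (1 - s) * `|p0 - p| < (1 - s) * e by rewrite ltr_pM2l// subr_gt0 lt_neqAle s1'.
have : s * `|p0 - q| <= s * e by rewrite ler_wpM2l// ltW.
lra.
Qed.

Lemma ball_segment (V : normedModType R) (p0 : V) (e : R) p (s : R) :
  ball p0 e p -> s \in `[0, 1]%R -> ball p0 e (p0 + s *: (p - p0)).
Proof.
move=> bp; have e0 : 0 < e.
  by move: bp; rewrite -ball_normE /=; exact: le_lt_trans.
exact: (ball_convex (ballxx p0 e0) bp).
Qed.

Context {V : normedModType R}.
Variables (p0 : V) (e : R) (a : V -> V -> R).
Let U := ball p0 e.
Hypothesis aD : forall p u v h, U p -> a p (u + h *: v) = a p u + h * a p v.
Hypothesis aC : forall v, Ck_on 1 U (a ^~ v).
Hypothesis a_closed : forall p u v, U p -> 'd (a ^~ u) p v = 'd (a ^~ v) p u.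

(** The homotopy operator centred at [p0], applied to the 1-form [a]. *)
Definition radial_integral (p : V) : R :=
  \int[mu]_(s in `[0, 1]) a (p0 + s *: (p - p0)) (p - p0).

Let oU : open U. Proof. exact: ball_open. Qed.

Let ac v p : U p -> {for p, continuous (a ^~ v)}.
Proof. by move=> Up; have := Ck_onW (aC v); exact. Qed.

Let dac v w p : U p -> {for p, continuous (fun q => 'd (a ^~ v) q w)}.
Proof. by move=> Up; have := Ck_on_d w (aC v); exact. Qed.

Let da v p : U p -> is_diff p (a ^~ v) ('d (a ^~ v) p).
Proof. by move=> Up; exact: Ck_on_is_diff (aC v) Up. Qed.

Section Direction.
Variables (p v : V) (x : R).
Hypothesis Ux : U (p + x *: v).

Let w := p - p0.
Let g (h s : R) : V := p0 + s *: (p + h *: v - p0).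

Let gE h s : g h s = p0 + s *: w + h *: (s *: v).
Proof.
by rewrite /g /w -!addrA; congr (_ + _); rewrite (addrCA _ (h *: v)) addrC scalerDr !scalerA mulrC.
Qed.

Let near_x : exists2 d : R, 0 < d & forall h : R, h \in `[x - d, x + d]%R -> U (p + h *: v).
Proof.
have : \forall h \near x, U (p + h *: v).
  have c : {for x, continuous (fun h : R => p + h *: v)}.
    exact: differentiable_continuous (is_diff_differentiable (is_diff_line p v x)).
  by apply: c; exact: open_nbhs_nbhs.
move=> /nbhs_ballP[r /= r0 H]; exists (r / 2); first exact: divr_gt0.
move=> h; rewrite in_itv/= => /andP[h1 h2]; apply: H; rewrite -ball_normE /=.
by rewrite ltr_norml; apply/andP; split; lra.
Qed.

(* The derivative in [h] of the integrand at [p + h *: v]. *)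
Let H (h s : R) : R :=
  s * ('d (a ^~ w) (g h s) v + h * 'd (a ^~ v) (g h s) v) + a (g h s) v.

Let gU h s : U (p + h *: v) -> s \in `[0, 1]%R -> U (g h s).
Proof. by move=> Uh s01; exact: ball_segment. Qed.

Let cg : continuous (fun z : R * R => g z.1 z.2).
Proof.
move=> z; apply: cvgD; first exact: cvg_cst.
apply: (@cvgZ _ _ _ _ _ (fun z : R * R => z.2) (fun z : R * R => p + z.1 *: v - p0)).
  exact: cvg_snd.
apply: cvgB; last exact: cvg_cst.
apply: cvgD; first exact: cvg_cst.
by apply: cvgZr_tmp; exact: cvg_fst.
Qed.

Let cgH (F : V -> R) (z : R * R) : {for g z.1 z.2, continuous F} ->
  {for z, continuous (fun z => F (g z.1 z.2))}.
Proof. by move=> cF; apply: (continuous_comp (@cg z)). Qed.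

Let cH (z : R * R) : U (p + z.1 *: v) -> z.2 \in `[0, 1]%R ->
  {for z, continuous (fun z => H z.1 z.2)}.
Proof.
move=> U1 z2; have Ug := gU U1 z2.
have c1 := @cgH (a ^~ v) z (ac (v := v) Ug).
have c2 := @cgH (fun q => 'd (a ^~ w) q v) z (dac (v := w) (w := v) Ug).
have c3 := @cgH (fun q => 'd (a ^~ v) q v) z (dac (v := v) (w := v) Ug).
have cf : {for z, continuous (fst : R * R -> R)} by exact: cvg_fst.
have cs : {for z, continuous (snd : R * R -> R)} by exact: cvg_snd.
exact: (continuousD (continuousM cs (continuousD c2 (continuousM cf c3))) c1).
Qed.

Let f (h s : R) : R := a (g h s) (p + h *: v - p0).

Let fE h s : U (p + h *: v) -> s \in `[0, 1]%R -> f h s = a (g h s) w + h * a (g h s) v.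
Proof. by move=> Uh s01; rewrite /f addrAC aD//; exact: gU. Qed.

Let df (h s : R) : U (p + h *: v) -> s \in `[0, 1]%R -> is_derive h 1 (f ^~ s) (H h s).
Proof.
move=> Uh s01; have Ug := gU Uh s01.
have dga u : is_derive h 1 (fun h => a (g h s) u) ('d (a ^~ u) (g h s) (s *: v)).
  rewrite (_ : (fun h => _) = (fun h => a (p0 + s *: w + h *: (s *: v)) u)); last first.
    by apply/funext => y; rewrite gE.
  by apply: (is_derive_line (f := a ^~ u)); rewrite -gE; exact: da.
have dF : is_derive h 1 (fun h => a (g h s) w + h * a (g h s) v) (H h s).
  apply: is_derive_eq (is_deriveD (dga w) (is_deriveM (is_derive_id h 1) (dga v))) _.
  have dZ u : 'd (a ^~ u) (g h s) (s *: v) = s * 'd (a ^~ u) (g h s) v.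
    exact: linearZ.
  rewrite /H !dZ /GRing.scale /= mulr1.
  move: ('d _ _ _) ('d _ _ _) (a _ _) => A B C; ring.
apply: (near_eq_is_derive _ dF).
have c : {for h, continuous (fun h : R => p + h *: v)}.
  exact: differentiable_continuous (is_diff_differentiable (is_diff_line p v h)).
have : \forall h' \near h, U (p + h' *: v) by apply: c; exact: open_nbhs_nbhs.
by apply: filterS => h' Uh'; rewrite fE.
Qed.

Let int_H : \int[mu]_(s in `[0, 1]) H x s = a (p + x *: v) v.
Proof.
have dF (s : R) : s \in `[0, 1]%R -> is_derive s 1 (fun s => s * a (g x s) v) (H x s).
  move=> s01; have Ug := gU Ux s01.
  have dga : is_derive s 1 (fun s => a (g x s) v) ('d (a ^~ v) (g x s) (p + x *: v - p0)).
    exact: (is_derive_line (f := a ^~ v) (da v Ug)).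
  apply: is_derive_eq (is_deriveM (is_derive_id s 1) dga) _.
  rewrite /GRing.scale /= mulr1 /H (@a_closed _ w v Ug); congr (s * _ + _).
  by rewrite addrAC -/w linearD linearZ.
have cF (s : R) : s \in `[0, 1]%R -> {for s, continuous (H x)}.
  move=> s01; have cHs := @cH (x, s) Ux s01.
  have cp := @continuous_pairl x s.
  exact: (@continuous_comp _ _ _ (fun s => (x, s)) (fun z => H z.1 z.2) s cp cHs).
by rewrite (Rintegral_derive dF cF) mul1r mul0r subr0 /g scale1r addrC subrK.
Qed.

(** Differentiation under the integral sign. The derivative of the integrand is
    bounded on a compact rectangle, and closedness of the form turns it into
    the derivative of [s * a (g x s) v] in [s]. *)
Lemma is_derive_radial_integral :
  is_derive x 1 (fun h => radial_integral (p + h *: v)) (a (p + x *: v) v).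
Proof.
have [d d0 Hd] := near_x.
have xI : `]x - d, x + d[%classic x by rewrite /= in_itv/=; apply/andP; split; lra.
have oc h : `]x - d, x + d[%classic h -> U (p + h *: v).
  by rewrite /= => hI; apply: Hd; move: hI; rewrite !in_itv/= => /andP[/ltW-> /ltW->].
have [C C0 HC] : exists2 C, 0 < C &
    forall h s : R, h \in `[x - d, x + d]%R -> s \in `[0, 1]%R -> `|H h s| <= C.
  pose K : set (R * R) := `[x - d, x + d] `*` `[0, 1].
  have cK : compact K by apply: compact_setX; exact: segment_compact.
  have /continuous_compact /(_ cK) /compact_bounded :
      {within K, continuous (fun z : R * R => H z.1 z.2)}.
    by apply: within_continuous => z [z1 z2]; apply: cH => //; exact: Hd.
  move=> /ex_strict_bound_gt0[C C0 HC]; exists C => // h s hI sI.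
  by apply/ltW/HC; exists (h, s).
have df' h s : `]x - d, x + d[%classic h -> `[0, 1]%classic s -> is_derive h 1 (f ^~ s) (H h s).
  by move=> hI sI; apply: df => //; exact: oc.
have intf h : `]x - d, x + d[%classic h -> mu.-integrable `[0, 1] (EFin \o f h).
  move=> hI; apply: continuous_compact_integrable; first exact: segment_compact.
  apply: within_continuous => s s01; have Ug := gU (oc h hI) s01.
  pose F q := a q (p + h *: v - p0).
  have cp := @continuous_pairl h s.
  have cF := @cgH F (h, s) (ac Ug).
  exact: (@continuous_comp _ _ _ (fun s => (h, s)) (fun z => F (g z.1 z.2)) s cp cF).
have intC : mu.-integrable `[0, 1] (EFin \o (cst C : R -> R)).
  apply: continuous_compact_integrable; first exact: segment_compact.
  by apply: within_continuous => s _; exact: cst_continuous.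
have der1 h s : `]x - d, x + d[%classic h -> `[0, 1]%classic s -> derivable (f ^~ s) h 1.
  by move=> hI sI; have [] := df' h s hI sI.
have ub h s : `]x - d, x + d[%classic h -> `[0, 1]%classic s ->
    `|partial1of2 f h s| <= cst C s.
  move=> hI sI; rewrite partial1of2E; have [_ ->] := df' h s hI sI.
  by apply: HC => //; move: hI; rewrite /= !in_itv/= => /andP[/ltW-> /ltW->].
have C0' (s : R) : 0 <= (cst C : R -> R) s by exact: ltW.
have D := @derivable_under_integral R _ _ mu f `[0, 1]
  (measurable_itv _) _ _ _ xI intf der1 _ C0' intC ub.
have E := @differentiation_under_integral R _ _ mu f `[0, 1]
  (measurable_itv _) _ _ _ xI intf der1 _ C0' intC ub.
split; first exact: D.
rewrite -derive1E [LHS]E -int_H; apply: eq_Rintegral => s /set_mem sI.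
by rewrite partial1of2E; have [_ ->] := df' x s xI sI.
Qed.

End Direction.
End Poincare.

(** * Row vectors and linear maps out of them *)

Section RowVectors.
Context {R : realType} {m : nat}.
Implicit Types (W : normedModType R) (v : 'rV[R]_m).

Lemma norm_coord_le v i : `|v ord0 i| <= `|v|.
Proof.
by rewrite {2}/Num.norm /= mx_normrE; exact: (le_bigmax _ (fun ij => `|v ij.1 ij.2|) (ord0, i)).
Qed.

Lemma linear_row_sum W (L : {linear 'rV[R]_m -> W}) v :
  L v = \sum_i v ord0 i *: L 'e_i.
Proof.
rewrite {1}(row_sum_delta v) linear_sum; apply: eq_bigr => i _.
by rewrite linearZ.
Qed.

Lemma linear_row_continuous W (L : {linear 'rV[R]_m -> W}) : continuous L.
Proof.
move=> v; rewrite (_ : (L : 'rV[R]_m -> W) = fun v => \sum_i v ord0 i *: L 'e_i); last first.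
  by apply/funext => u; exact: linear_row_sum.
apply: (@Ck_on_sum _ _ _ 0 setT _ (fun i v => v ord0 i *: L 'e_i) openT) => // i p _.
exact/differentiable_continuous/differentiableZl/differentiable_coord.
Qed.

(** The factor [k] is the minimum on the unit sphere, which is compact because
    the dimension is finite. *)
Lemma injective_linear_bound W (L : {linear 'rV[R]_m -> W}) : injective L ->
  exists2 k : R, 0 < k & forall v, k * `|v| <= `|L v|.
Proof.
move=> injL; pose S := [set v : 'rV[R]_m | `|v| = 1].
have nS v : v != 0 -> S (`|v|^-1 *: v).
  move=> v0; have nv : `|v| != 0 by rewrite normr_eq0.
  by rewrite /S /= normrZ ger0_norm ?invr_ge0// mulVf.
(* In dimension 0 the unit sphere is empty. *)
have [[u Su]|S0] := pselect (S !=set0); last first.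
  exists 1 => // v; have [->|v0] := eqVneq v 0; first by rewrite normr0 mulr0.
  by exfalso; apply: S0; exists (`|v|^-1 *: v); exact: nS.
have cS : compact S.
  apply: bounded_closed_compact.
    by exists 1; split=> // M M1 v /= ->; exact: ltW.
  rewrite (_ : S = Num.norm @^-1` [set (1 : R)])//.
  by apply: closed_comp; [move=> v _; exact: norm_continuous|exact: closed_eq].
have cL : {within S, continuous (fun v => `|L v|)}.
  apply: continuous_subspaceT => v; apply: continuous_comp.
    exact: linear_row_continuous.
  exact: norm_continuous.
have [c /set_mem Sc Hc] := compact_EVT_min (ex_intro _ u Su) cS cL.
exists `|L c|.
  rewrite normr_gt0; apply/eqP => Lc0.
  have c0 : c = 0 by apply: injL; rewrite Lc0 linear0.
  by move: Sc; rewrite /S /= c0 normr0 => /eqP; rewrite eq_sym oner_eq0.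
move=> v; have [->|v0] := eqVneq v 0; first by rewrite normr0 mulr0.
have := Hc _ (mem_set (nS v v0)).
by rewrite linearZ normrZ ger0_norm ?invr_ge0// ler_pdivlMl ?normr_gt0// mulrC.
Qed.

(** Continuous directional derivatives that are linear in the direction make
    the function differentiable: along the segment from [p] to [p + h] the mean
    value theorem compares the increment with [a p h]. *)
Lemma is_diff_directional (F : 'rV[R]_m -> R) (a : 'rV[R]_m -> 'rV[R]_m -> R)
    (U : set 'rV[R]_m) p : open U -> U p ->
  (forall q u v h, U q -> a q (u + h *: v) = a q u + h * a q v) ->
  (forall v, {for p, continuous (a ^~ v)}) ->
  (forall q v (x : R), U (q + x *: v) ->
     is_derive x 1 (fun h : R => F (q + h *: v)) (a (q + x *: v) v)) ->
  is_diff p F (a p).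
Proof.
move=> oU Up aD ac dF.
have alin q : U q -> linear (a q).
  by move=> Uq h u v; rewrite [h *: u + v]addrC aD// [RHS]addrC.
pose La q (Uq : U q) : {linear 'rV[R]_m -> R} :=
  HB.pack (a q) (GRing.isLinear.Build R 'rV[R]_m R _ (a q) (alin q Uq)).
suff : is_diff p F (La p Up) by [].
apply/is_diff_epsP; first exact: linear_row_continuous.
move=> e e0.
(* [m] directions contribute; [m.+1] is nonzero also in dimension 0. *)
have e1 : 0 < e / m.+1%:R by rewrite divr_gt0.
have near_e : \forall q \near p, forall i, `|a q 'e_i - a p 'e_i| <= e / m.+1%:R.
  apply: (@filter_forall _ _
    (fun i q => is_true (`|a q 'e_i - a p 'e_i| <= e / m.+1%:R)) (nbhs p)) => i.
  move/cvgrPdist_le : (ac 'e_i) => /(_ _ e1).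
  by apply: filterS => q; rewrite distrC.
have near_a : \forall q \near p, U q /\ forall i, `|a q 'e_i - a p 'e_i| <= e / m.+1%:R.
  by apply: filterI near_e; exact: open_nbhs_nbhs.
have /nbhs_ballP[r /= r0 Hr] := near_a.
have : \forall h \near (0 : 'rV[R]_m), `|h| < r by exact: nbhs0_lt.
apply: filterS => h hr.
have Uh x : 0 <= x <= 1 -> ball p r (p + x *: h).
  move=> /andP[x0 x1]; rewrite -ball_normE /= opprD addrA subrr sub0r normrN normrZ ger0_norm//.
  by apply: le_lt_trans hr; rewrite ler_piMl.
have dg (x : R) : x \in `[0, 1]%R ->
    is_derive x 1 (fun x : R => F (p + x *: h)) (a (p + x *: h) h).
  by rewrite in_itv => xI; apply: dF; exact: (Hr _ (Uh _ xI)).1.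
have [c cI] := MVT_derive ltr01 dg.
rewrite scale1r scale0r addr0 subr0 mulr1 (addrC p) => ->.
have cI' : 0 <= c <= 1 by move: cI; rewrite in_itv/= => /andP[/ltW-> /ltW->].
have [Uc Hc] := Hr _ (Uh _ cI').
have aE q (Uq : U q) v : a q v = \sum_i v ord0 i * a q 'e_i.
  exact: (linear_row_sum (La q Uq)).
rewrite /= (aE _ Uc) (aE _ Up) -sumrB (le_trans (ler_norm_sum _ _ _))//.
apply: (@le_trans _ _ (\sum_(i < m) `|h| * (e / m.+1%:R))).
  apply: ler_sum => i _; rewrite -mulrBr normrM.
  by apply: ler_pM => //; first [exact: norm_coord_le|exact: Hc].
rewrite sumr_const card_ord -[leLHS]mulr_natr -mulrA mulrC ler_wpM2r//.
by rewrite mulrAC ler_pdivrMr// ler_wpM2l ?(ltW e0)// ler_nat.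
Qed.

End RowVectors.

(** * Tangent vectors of an embedded submanifold *)

Section Tangent.
Context {R : realType} {k : nat} {W : normedModType R}.
Variables (S : set W) (V : set 'rV[R]_k) (psi : 'rV[R]_k -> W) (v0 : 'rV[R]_k).
Hypothesis oV : open V.
Hypothesis Vv0 : V v0.
Hypothesis dpsi : differentiable psi v0.
Hypothesis dpsi_inj : injective ('d psi v0).
Hypothesis psi_open : forall V', open V' -> V' `<=` V ->
  exists2 U, open U & psi @` V' = S `&` U.

(** A curve in [S] through [psi v0] lifts continuously to parameters [u].
    Because ['d psi v0] expands lengths, [u] tends to [v0] at least linearly, so
    the difference quotients of the curve are those of ['d psi v0] up to an
    arbitrarily small error. *)
Lemma tangent_vector_closure w :
  tangent_vector S (psi v0) w -> closure (range ('d psi v0)) w.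
Proof.
move=> [D [c [oD D0 sc [cS c0 cw]]]].
have [kap kap0 Hkap] := injective_linear_bound dpsi_inj.
have dc : differentiable c 0 by have [+ _] := sc 1%N; exact.
move=> B /nbhs_ballP[e /= e0 HB].
(* [e1] bounds the error on the curve and [e2] the error on [psi]. They are
   chosen so that, at time [s], each contributes at most [e / 4 * s]; the bound
   [kap / 2] in [e2] gives [`|u| <= 2 * M * s / kap]. *)
pose M := `|w| + 1.
have M0 : 0 < M by rewrite /M ltr_pwDr.
pose e1 := Num.min 1 (e / 4).
have e10 : 0 < e1 by rewrite lt_min ltr01 divr_gt0.
pose e2 := Num.min (kap / 2) (e * kap / (8 * M)).
have e20 : 0 < e2.
  by rewrite lt_min; apply/andP; split; apply: divr_gt0 => //; apply: mulr_gt0.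
have /is_diff_epsP-/(_ (diff_continuous dpsi))/(_ _ e20)/nbhs_ballP[r /= r0 Hr] :=
  differentiableP dpsi.
have oVr : open (V `&` ball v0 r) by apply: openI => //; exact: ball_open.
have [U oU HU] := psi_open oVr (@subIsetl _ _ _).
have [_ Uc0] : (S `&` U) (c 0).
  rewrite -HU c0; exists v0 => //; split; [exact: Vv0|exact: ballxx].
have Uc : \forall s \near 0, U (c s).
  by apply: (differentiable_continuous dc); exact: open_nbhs_nbhs.
have Dc : \forall s \near 0, D s by exact: open_nbhs_nbhs.
have /is_diff_epsP-/(_ (diff_continuous dc))/(_ _ e10) Hc := differentiableP dc.
have : \forall s \near (0 : R), [/\ U (c s), D s & `|c (s + 0) - c 0 - 'd c 0 s| <= e1 * `|s|].
  by near=> s; split; near: s.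
move=> /nbhs_ballP[d /= d0 Hd].
have d2 : 0 < d / 2 by rewrite divr_gt0.
have [Us Ds] : [/\ U (c (d / 2)), D (d / 2)
    & `|c (d / 2 + 0) - c 0 - 'd c 0 (d / 2)| <= e1 * `|d / 2|].
  apply: Hd; rewrite -ball_normE /= sub0r normrN gtr0_norm//.
  by rewrite ltr_pdivrMr// mulr_natr mulr2n ltrDl.
move: (d / 2) d2 Us Ds => s s0 Us Ds.
rewrite addr0 gtr0_norm// (_ : 'd c 0 s = s *: w); last first.
  by rewrite (diff1E dc) cw.
move=> cs.
have [q [Vq qr] qs] : (psi @` (V `&` ball v0 r)) (c s) by rewrite HU; split=> //; exact: cS.
pose u := q - v0.
have ur : `|u| < r by move: qr; rewrite -ball_normE /= distrC.
have := Hr u; rewrite -ball_normE /= sub0r normrN /u subrK qs -c0 -/u => /(_ ur) psis.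
have cc : `|c s - c 0| <= M * s.
  rewrite -(subrK (s *: w) (c s - c 0)); apply: (le_trans (ler_normD _ _)).
  rewrite normrZ (gtr0_norm s0) mulrDl mul1r mulrC addrC lerD2l.
  by apply: (le_trans cs); rewrite ler_piMl ?(ltW s0)// ge_min lexx.
have u1 : kap / 2 * `|u| <= M * s.
  have h1 : kap * `|u| <= M * s + e2 * `|u|.
    rewrite (le_trans (Hkap u))// -[X in `|X|](subKr (c s - c 0)).
    by rewrite (le_trans (ler_normB _ _))// lerD.
  have h2 : e2 * `|u| <= kap / 2 * `|u| by rewrite ler_wpM2r// ge_min lexx.
  have h3 : kap * `|u| = kap / 2 * `|u| + kap / 2 * `|u| by rewrite -mulrDl -splitr.
  lra.
have u2 : e2 * `|u| <= e / 4 * s.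
  have : e2 * `|u| <= e * kap / (8 * M) * `|u| by rewrite ler_wpM2r// ge_min lexx orbT.
  move=> /le_trans; apply.
  rewrite (_ : e * kap / (8 * M) * `|u| = e / (4 * M) * (kap / 2 * `|u|)); last first.
    by field; rewrite gt_eqF.
  rewrite (_ : e / 4 * s = e / (4 * M) * (M * s)); last by field; rewrite gt_eqF.
  by rewrite ler_wpM2l// ltW// divr_gt0// mulr_gt0.
exists ('d psi v0 (s^-1 *: u)); split; first by exists (s^-1 *: u).
apply: HB; rewrite -ball_normE /= -(ltr_pM2l s0) -{1}(gtr0_norm s0) -normrZ scalerBr.
have dq : 'd psi v0 (s^-1 *: u) = s^-1 *: 'd psi v0 u by rewrite linearZ.
rewrite dq scalerA mulfV ?gt_eqF// scale1r.
have -> : s *: w - 'd psi v0 u = (c s - c 0 - 'd psi v0 u) - (c s - c 0 - s *: w).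
  by rewrite opprB [RHS]addrC [RHS]addrA subrK.
rewrite (le_lt_trans (ler_normB _ _))//.
have : e1 * s <= e / 4 * s by rewrite ler_wpM2r ?(ltW s0)// ge_min lexx orbT.
have : 0 < s * e by rewrite mulr_gt0.
lra.
Unshelve. all: by end_near. Qed.

End Tangent.

(** * Hermitian linear algebra of C^n in real coordinates *)

(* Multiplication by [e^(it)], not the rotation of sequences. *)
Local Notation rot := Defs.rot.

Section Hermitian.
Context {R : realType} {n : nat}.
Implicit Types (z u v w : cplx R n) (c t : R).

(** Multiplication by i. The Euclidean inner product of [u] and [v] is then
    [lambda u (mulI v)], so that all the metric and symplectic identities are
    statements about [lambda] alone. *)
Definition mulI z : cplx R n := (- z.2, z.1).

Lemma lambdaDl u v w : lambda (u + v) w = lambda u w + lambda v w.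
Proof. by rewrite -big_split; apply: eq_bigr => i _; rewrite /= !mxE /=; ring. Qed.

Lemma lambdaZl c u w : lambda (c *: u) w = c * lambda u w.
Proof. by rewrite [RHS]mulr_sumr; apply: eq_bigr => i _; rewrite /= !mxE /=; ring. Qed.

Lemma lambdaC u v : lambda u v = - lambda v u.
Proof. by rewrite -sumrN; apply: eq_bigr => i _; ring. Qed.

Lemma lambdaDr u v w : lambda w (u + v) = lambda w u + lambda w v.
Proof. by rewrite lambdaC lambdaDl opprD -!lambdaC. Qed.

Lemma lambdaZr c u w : lambda w (c *: u) = c * lambda w u.
Proof. by rewrite lambdaC lambdaZl -mulrN -lambdaC. Qed.

Lemma lambda0l u : lambda 0 u = 0.
Proof. by rewrite -(scale0r 0) lambdaZl mul0r. Qed.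

Lemma lambdaxx u : lambda u u = 0.
Proof. by apply: big1 => i _; rewrite mulrC subrr. Qed.

Lemma lambda_mulI u v : lambda (mulI u) (mulI v) = lambda u v.
Proof. by apply: eq_bigr => i _; rewrite /= !mxE /=; ring. Qed.

Lemma mulIK z : mulI (mulI z) = - z.
Proof. by case: z. Qed.

Lemma lambda_mulIl u v : lambda (mulI u) v = - lambda u (mulI v).
Proof. by rewrite -sumrN; apply: eq_bigr => i _; rewrite /= !mxE /=; ring. Qed.

Lemma lambda_mulIC u v : lambda u (mulI v) = lambda v (mulI u).
Proof. by apply: eq_bigr => i _; rewrite /= !mxE /=; ring. Qed.

Lemma normsqE z : normsq z = lambda z (mulI z).
Proof. by apply: eq_bigr => i _; rewrite /= !mxE /=; ring. Qed.

Lemma normsqZ c z : normsq (c *: z) = c ^+ 2 * normsq z.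
Proof. by rewrite [RHS]mulr_sumr; apply: eq_bigr => i _; rewrite /= !mxE /=; ring. Qed.

Lemma mulI_linear : linear mulI.
Proof. by move=> c u v; congr pair => /=; rewrite // opprD scalerN. Qed.

HB.instance Definition _ :=
  GRing.isLinear.Build R (cplx R n) (cplx R n) _ mulI mulI_linear.

Lemma mulI_continuous : continuous mulI.
Proof.
move=> z; apply: (@cvg_pair _ _ _ (nbhs z) (nbhs (- z.2)) (nbhs z.1)).
  by apply: cvgN; exact: cvg_snd.
exact: cvg_fst.
Qed.

Lemma phase_rotE t z : rot t z = cos t *: z + sin t *: mulI z.
Proof.
by congr pair; rewrite /= ?scalerN// addrC.
Qed.

Lemma phase_rot0 z : rot 0 z = z.
Proof. by rewrite phase_rotE cos0 sin0 scale1r scale0r addr0. Qed.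

Lemma phase_rot_rot t c z : rot t (rot c z) = rot (t + c) z.
Proof.
by congr pair; apply/matrixP => i j; rewrite !mxE cosD sinD; ring.
Qed.

Lemma phase_rotK t : cancel (rot t) (@Defs.rot R n (- t)).
Proof. by move=> z; rewrite phase_rot_rot addNr phase_rot0. Qed.

Lemma rot_mulI t z : rot t (mulI z) = mulI (rot t z).
Proof. by congr pair; apply/matrixP => i j; rewrite !mxE; ring. Qed.

Lemma phase_rotD t u v : rot t (u + v) = rot t u + rot t v.
Proof. by congr pair; apply/matrixP => i j; rewrite !mxE; ring. Qed.

Lemma lambda_rot t u v : lambda (rot t u) (rot t v) = lambda u v.
Proof.
rewrite !phase_rotE !(lambdaDl, lambdaDr, lambdaZl, lambdaZr) lambda_mulI lambda_mulIl.
have /(_ t) := @cos2Dsin2 R; rewrite !expr2 => E.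
rewrite -[RHS]mul1r -E; ring.
Qed.

Lemma normsq_rot t z : normsq (rot t z) = normsq z.
Proof. by rewrite !normsqE -rot_mulI lambda_rot. Qed.

Lemma lambda_bilinear :
  bilinear_for
    (GRing.Scale.Law.clone _ _ *:%R _) (GRing.Scale.Law.clone _ _ *:%R _)
    (@lambda R n : cplx R n -> cplx R n -> R).
Proof.
split=> [u c v w|u c v w] /=; first by rewrite lambdaDl lambdaZl.
by rewrite lambdaDr lambdaZr.
Qed.

HB.instance Definition _ :=
  bilinear_isBilinear.Build R (cplx R n) (cplx R n) R _ _ (@lambda R n)
    lambda_bilinear.

Lemma lambda_continuous :
  continuous (fun z : cplx R n * cplx R n => lambda z.1 z.2).
Proof.
pose F (i : 'I_n) (y : cplx R n * cplx R n) : R :=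
  y.1.1 ord0 i * y.2.2 ord0 i - y.1.2 ord0 i * y.2.1 ord0 i.
have coord (g : cplx R n * cplx R n -> 'rV[R]_n) i :
    continuous g -> continuous (fun y => g y ord0 i).
  move=> cg y.
  have cc := differentiable_continuous (differentiable_coord (g y) ord0 i).
  exact: (continuous_comp (cg y) cc).
have comp (f : cplx R n * cplx R n -> cplx R n) (g : cplx R n -> 'rV[R]_n) :
    continuous f -> continuous g -> continuous (fun y => g (f y)).
  by move=> cf cg y; have H := continuous_comp (cf y) (cg (f y)); exact: H.
have c1 (V W : normedModType R) : continuous (fst : V * W -> V) by move=> y; exact: cvg_fst.
have c2 (V W : normedModType R) : continuous (snd : V * W -> W) by move=> y; exact: cvg_snd.
have cF i y : setT y -> {for y, continuous (F i)}.
  move=> _; exact: (continuousB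
    (continuousM (coord _ i (comp _ _ (c1 _ _) (c1 _ _)) y)
      (coord _ i (comp _ _ (c2 _ _) (c2 _ _)) y))
    (continuousM (coord _ i (comp _ _ (c1 _ _) (c2 _ _)) y)
      (coord _ i (comp _ _ (c2 _ _) (c1 _ _)) y))).
by move=> y; exact: (@Ck_on_sum _ _ _ 0 setT _ F openT cF y).
Qed.

End Hermitian.

Section Embedding.
Context {R : realType} {m : nat}.
Implicit Types (z u v : cplx R m) (a b c : R).

(** The point of C^(m+1) whose last coordinate is [a + i b]. *)
Definition emb z a b : cplx R (m + 1) :=
  (row_mx z.1 (const_mx a), row_mx z.2 (const_mx b)).

Lemma embD z a b z' a' b' : emb z a b + emb z' a' b' = emb (z + z') (a + a') (b + b').
Proof.
by congr pair; rewrite /= add_row_mx; congr row_mx;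
  apply/matrixP => i j; rewrite !mxE.
Qed.

Lemma embZ c z a b : c *: emb z a b = emb (c *: z) (c * a) (c * b).
Proof.
by congr pair; rewrite /= scale_row_mx; congr row_mx;
  apply/matrixP => i j; rewrite !mxE.
Qed.

Lemma emb_inj z a b z' a' b' : emb z a b = emb z' a' b' -> [/\ z = z', a = a' & b = b'].
Proof.
move=> [/eq_row_mx[z1 /matrixP/(_ ord0 ord0)] ea /eq_row_mx[z2 /matrixP/(_ ord0 ord0)] eb].
by move: ea eb; rewrite !mxE; split=> //; case: z z' z1 z2 => [? ?] [? ?] /= -> ->.
Qed.

Lemma mulI_emb z a b : mulI (emb z a b) = emb (mulI z) (- b) a.
Proof.
by congr pair; rewrite /= opp_row_mx; congr row_mx;
  apply/matrixP => i j; rewrite !mxE.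
Qed.

Lemma lambda_emb z a b z' a' b' :
  lambda (emb z a b) (emb z' a' b') = lambda z z' + (a * b' - b * a').
Proof.
rewrite /lambda big_split_ord big_ord1 /=; congr (_ + _).
  by apply: eq_bigr => i _; rewrite !row_mxEl.
by rewrite !row_mxEr !mxE.
Qed.

Lemma normsq_emb z a b : normsq (emb z a b) = normsq z + (a ^+ 2 + b ^+ 2).
Proof. by rewrite !normsqE mulI_emb lambda_emb; congr (_ + _); ring. Qed.

Definition emb0 z : cplx R (m + 1) := emb z 0 0.

Lemma emb0_linear : linear emb0.
Proof. by move=> c u v; rewrite /emb0 embZ embD !mulr0 !addr0. Qed.

HB.instance Definition _ :=
  GRing.isLinear.Build R (cplx R m) (cplx R (m + 1)) _ emb0 emb0_linear.

Lemma emb0_continuous : continuous emb0.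
Proof.
have rlin : linear (fun x : 'rV[R]_m => row_mx x (const_mx 0) : 'rV[R]_(m + 1)).
  by move=> c x y; rewrite scale_row_mx add_row_mx scaler0 addr0.
pose r : {linear 'rV[R]_m -> 'rV[R]_(m + 1)} :=
  HB.pack (fun x : 'rV[R]_m => row_mx x (const_mx 0) : 'rV[R]_(m + 1))
    (GRing.isLinear.Build R 'rV[R]_m 'rV[R]_(m + 1) _ _ rlin).
have cr : continuous r by exact: linear_row_continuous.
move=> z; apply: (@cvg_pair _ _ _ (nbhs z) (nbhs (r z.1)) (nbhs (r z.2))
    _ _ _ (r \o fst) (r \o snd)).
  by apply: (continuous_comp (@cvg_fst _ _ _ _ _)); exact: cr.
by apply: (continuous_comp (@cvg_snd _ _ _ _ _)); exact: cr.
Qed.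

Lemma embE z a : emb z a 0 = emb0 z + a *: emb 0 1 0.
Proof. by rewrite /emb0 embZ embD scaler0 mulr0 mulr1 !addr0 add0r. Qed.

Lemma lift_ofE (T : topologicalType) (f : T -> cplx R m) t x :
  lift_of f t x = rot (t x) (emb (f x) (Num.sqrt (1 - normsq (f x))) 0).
Proof. by []. Qed.

End Embedding.

(** * The lift in a coordinate chart *)

Section LambdaCalculus.
Context {R : realType} {n : nat} {V : normedModType R}.
Implicit Types f g : V -> cplx R n.

Let lambdaB : {bilinear cplx R n -> cplx R n -> R} := @lambda R n.

Let mulIL : {linear cplx R n -> cplx R n} := @mulI R n.

Let lambdaB_continuous : continuous (fun z => lambdaB z.1 z.2).
Proof. exact: (@lambda_continuous R n). Qed.

Lemma Ck_on_lambda k (U : set V) f g : open U -> Ck_on k U f -> Ck_on k U g ->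
  Ck_on k U (fun p => lambda (f p) (g p)).
Proof.
by move=> oU; exact: (@Ck_on_bilin R V _ _ _ lambdaB k U f g oU lambdaB_continuous).
Qed.

Lemma is_diff_lambda f g p df dg : is_diff p f df -> is_diff p g dg ->
  is_diff p (fun q => lambda (f q) (g q))
    (fun v => lambda (f p) (dg v) + lambda (df v) (g p)).
Proof. exact: (@is_diff_bilin R V _ _ _ lambdaB f g p df dg lambdaB_continuous). Qed.

Lemma is_diff_mulI f p df :
  is_diff p f df -> is_diff p (fun q => mulI (f q)) (fun v => mulI (df v)).
Proof. exact: (@is_diff_lincomp R V _ _ mulIL f p df mulI_continuous). Qed.

Lemma Ck_on_mulI k (U : set V) f : open U -> Ck_on k U f ->
  Ck_on k U (fun p => mulI (f p)).
Proof. by move=> oU; exact: (@Ck_on_lincomp R V _ _ k U mulIL f oU mulI_continuous). Qed.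

End LambdaCalculus.

Section LocalLift.
Context {R : realType} {m : nat} {V : normedModType R}.
Variables (U : set V) (phi : V -> cplx R m) (F : V -> R).
Hypothesis oU : open U.
Hypothesis phi_smooth : smooth_on U phi.
Hypothesis phi_ball : forall p, U p -> normsq (phi p) < 1.
Hypothesis dF : forall p, U p -> is_diff p F (fun v => tau (phi p) ('d phi p v)).

Let s (p : V) := Num.sqrt (1 - normsq (phi p)).
Let b (p : V) := emb (phi p) (s p) 0.
Let L (p : V) := rot (F p) (b p).
Let db (p v : V) := emb ('d phi p v) ('d s p v) 0.

Let s2_gt0 p : U p -> 0 < 1 - normsq (phi p).
Proof. by move=> Up; rewrite subr_gt0 phi_ball. Qed.

Let s_gt0 p : U p -> 0 < s p.
Proof. by move=> Up; rewrite sqrtr_gt0 s2_gt0. Qed.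

Let s_smooth k : Ck_on k U s.
Proof.
apply: Ck_on_sqrt => //.
apply: Ck_onD => //; first exact: Ck_on_cst.
apply: Ck_onN => //.
apply: (Ck_on_eq oU (f := fun p => lambda (phi p) (mulI (phi p)))).
  by move=> p _; rewrite normsqE.
by apply: Ck_on_lambda => //; exact: Ck_on_mulI.
Qed.

Let b_smooth k : Ck_on k U b.
Proof.
apply: (Ck_on_eq oU (f := fun p => emb0 (phi p) + s p *: emb 0 1 0)).
  by move=> p _; rewrite /b [RHS]embE.
apply: Ck_onD => //.
  by apply: Ck_on_lincomp => //; exact: emb0_continuous.
by apply: Ck_onZ => //; exact: Ck_on_cst.
Qed.

Let phi_diff p : U p -> is_diff p phi ('d phi p).
Proof. by move=> Up; exact: Ck_on_is_diff (phi_smooth 1) Up. Qed.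

Let b_diff p : U p -> is_diff p b (db p).
Proof.
move=> Up.
have ds := Ck_on_is_diff (s_smooth 1) Up.
have d1 := is_diff_lincomp (@emb0_continuous R m) (phi_diff Up).
have d2 := is_diff_scale ds (is_diff_cst (emb 0 1 0 : cplx R (m + 1)) p).
apply: is_diff_ext (is_diffD d1 d2) => [q|v]; first by rewrite /b [RHS]embE.
by rewrite /db [RHS]embE !fctE scaler0 add0r.
Qed.

(** The phase inherits smoothness from its differential. *)
Lemma phase_smooth : smooth_on U F.
Proof.
case=> [|k].
  move=> p Up; exact: differentiable_continuous (is_diff_differentiable (dF Up)).
apply: (Ck_onS oU dF) => v; apply: Ck_onN => //; apply: Ck_on_lambda => //.
exact: Ck_on_d (phi_smooth k.+1).
Qed.

Lemma lift_smooth : smooth_on U L.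
Proof.
move=> k.
apply: (Ck_on_eq oU (f := fun p => cos (F p) *: b p + sin (F p) *: mulI (b p))).
  by move=> p _; rewrite /L phase_rotE.
have [Hc Hs] := Ck_on_cos_sin oU (phase_smooth k).
apply: Ck_onD => //; apply: Ck_onZ => //.
exact: Ck_on_mulI.
Qed.

(** The phase moves the point along its Hopf circle, whose direction is that of
    [mulI (b p)]. *)
Lemma lift_diff p : U p ->
  is_diff p L (fun v => rot (F p) (db p v + tau (phi p) ('d phi p v) *: mulI (b p))).
Proof.
move=> Up; have bd := b_diff Up.
have cd := is_diff_comp1 (is_derive_cos (F p)) (dF Up).
have sd := is_diff_comp1 (is_derive_sin (F p)) (dF Up).
have Jd := is_diff_mulI bd.
apply: is_diff_ext (is_diffD (is_diff_scale cd bd) (is_diff_scale sd Jd)).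
  by move=> q; rewrite /L phase_rotE.
move=> v; rewrite !fctE /= phase_rotD phase_rotE.
set a := tau _ _.
move: (b p) (db p v) => x y.
by congr pair; apply/matrixP => i j; rewrite !mxE /=; ring.
Qed.

Let normsq_b p : U p -> normsq (b p) = 1.
Proof.
move=> Up; rewrite normsq_emb sqr_sqrtr ?(ltW (s2_gt0 Up))//.
by rewrite expr0n addr0 addrC subrK.
Qed.

Let b_orth p v : U p -> lambda (b p) (mulI (db p v)) = 0.
Proof.
move=> Up; have bd := b_diff Up.
have d1 := is_diff_lambda bd (is_diff_mulI bd).
have d2 : is_diff p (fun q => lambda (b q) (mulI (b q))) (0 : V -> R).
  apply: (is_diff_near _ (is_diff_cst (1 : R) p)).
  by apply: filterS (open_nbhs_nbhs (conj oU Up)) => q Uq; rewrite -normsqE normsq_b.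
have := is_diffE d1 v; rewrite (is_diffE d2 v) /= (lambda_mulIC (db p v)) => /eqP.
by rewrite eq_sym -mulr2n mulrn_eq0 /= => /eqP.
Qed.

Let tau_db p v : lambda (b p) (db p v) = - tau (phi p) ('d phi p v).
Proof. by rewrite lambda_emb /tau opprK mulr0 mul0r subr0 addr0. Qed.

Lemma lift_orth p v : U p -> lambda (L p) (mulI ('d L p v)) = 0.
Proof.
move=> Up; rewrite (is_diffE (lift_diff Up)) -rot_mulI lambda_rot.
rewrite linearD linearZ /= lambdaDr lambdaZr b_orth// mulIK add0r.
by rewrite -scaleN1r lambdaZr lambdaxx !mulr0.
Qed.

(** The real last coordinate of [b] contributes nothing to [lambda (b p) (db p v)],
    and the derivative of the phase cancels the contribution of [phi]. *)
Lemma lift_legendrian p v : U p -> lambda (L p) ('d L p v) = 0.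
Proof.
move=> Up; rewrite (is_diffE (lift_diff Up)) lambda_rot lambdaDr lambdaZr tau_db.
by rewrite -normsqE normsq_b// mulr1 addNr.
Qed.

(** The cross terms pair the circle direction [mulI (b p)] with velocities of [b],
    which are tangent to the sphere. *)
Lemma lift_isotropic p u v : U p -> lambda ('d phi p u) ('d phi p v) = 0 ->
  lambda ('d L p u) ('d L p v) = 0.
Proof.
move=> Up H; rewrite !(is_diffE (lift_diff Up)) lambda_rot.
rewrite !(lambdaDl, lambdaDr, lambdaZl, lambdaZr) lambdaxx lambda_mulIl b_orth//.
rewrite (lambda_mulIC (db p u)) b_orth// lambda_emb H; ring.
Qed.

(** The imaginary part of the last coordinate of a velocity is the derivative of
    the phase times the positive number [s p]. *)
Lemma lift_immersive p : U p -> injective ('d phi p) -> injective ('d L p).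
Proof.
move=> Up inj u v; rewrite !(is_diffE (lift_diff Up)) => /(can_inj (phase_rotK _)).
rewrite !mulI_emb !embZ !embD => /emb_inj[E1 _].
rewrite !add0r => /(mulIf (lt0r_neq0 (s_gt0 Up))) E2.
by move: E1; rewrite E2 => /addIr /inj.
Qed.

(** The lift defined on the manifold contains the possibly discontinuous phase,
    but it coincides with a local lift on a ball, and first-order properties are
    local. *)
Lemma lift_tangent (psi : V -> cplx R (m + 1)) p : (forall q, U q -> L q = psi q) ->
  U p -> (forall u v, lambda ('d phi p u) ('d phi p v) = 0) ->
  injective ('d phi p) ->
  [/\ forall v, lambda (psi p) (mulI ('d psi p v)) = 0,
      forall v, lambda (psi p) ('d psi p v) = 0,
      forall u v, lambda ('d psi p u) ('d psi p v) = 0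
    & injective ('d psi p)].
Proof.
move=> Lpsi Up iso inj.
have near_psi : \forall q \near p, L q = psi q.
  by apply: filterS (open_nbhs_nbhs (conj oU Up)) => q /Lpsi.
have dL := differentiableP (is_diff_differentiable (lift_diff Up)).
have dE := is_diffE (is_diff_near near_psi dL).
rewrite -(Lpsi p Up); split=> [v|v|u v|u v].
- by rewrite dE; exact: lift_orth.
- by rewrite dE; exact: lift_legendrian.
- have H := lift_isotropic Up (iso u v).
  by rewrite [X in lambda X _]dE [X in lambda _ X]dE.
- move=> E; apply: (lift_immersive Up inj).
  by rewrite -[LHS]dE -[RHS]dE.
Qed.

End LocalLift.

(** * Paths in charts *)

Section ChartPaths.
Context {R : realType} {m : nat} {T : topologicalType}.
Variable A : set (chart R m T).
Implicit Types (c : chart R m T) (x y : T).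

Lemma crd_in_dom c p : (crd c @` dom c) p -> dom c (par c p) /\ crd c (par c p) = p.
Proof. by move=> [y dy <-]; rewrite crdK. Qed.

Lemma open_crd c (O : set T) : open O -> open (crd c @` (dom c `&` O)).
Proof.
move=> oO; rewrite openE => p [x [dx Ox] <-].
have Dp : (crd c @` dom c) (crd c x) by exists x.
have n1 : nbhs (crd c x) (crd c @` dom c).
  by apply: open_nbhs_nbhs; split=> //; exact: crd_open.
have n2 : nbhs (crd c x) (par c @^-1` O).
  by apply: (par_cont Dp); apply: open_nbhs_nbhs; split=> //=; rewrite crdK.
apply: filterS (filterI n1 n2) => q [Dq Oq].
have [dq eq] := crd_in_dom Dq.
by exists (par c q).
Qed.

Lemma open_dom_crd c (U : set 'rV[R]_m) : open U -> open (dom c `&` crd c @^-1` U).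
Proof.
move=> oU; rewrite openE => x [dx Ux].
apply: filterI; first by apply: open_nbhs_nbhs; split=> //; exact: dom_open.
by apply: (crd_cont dx); exact: open_nbhs_nbhs.
Qed.

Definition segment c (p q : 'rV[R]_m) (s : R) : T := par c (p + s *: (q - p)).

Lemma segment0 c p q : segment c p q 0 = par c p.
Proof. by rewrite /segment scale0r addr0. Qed.

Lemma segment1 c p q : segment c p q 1 = par c q.
Proof. by rewrite /segment scale1r addrC subrK. Qed.

(** In another chart the segment is the transition map after an affine map. *)
Lemma segment_arc c p0 e p q : smooth_atlas A -> A c ->
  ball p0 e `<=` crd c @` dom c -> ball p0 e p -> ball p0 e q ->
  smooth_arc A (segment c p q).
Proof.
move=> [_ At] Ac be bp bq.
pose l (s : R) := p + s *: (q - p).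
have cl : continuous l.
  by move=> s; exact: differentiable_continuous (is_diff_differentiable (is_diff_line p (q - p) s)).
have ol (U : set 'rV[R]_m) : open U -> open (l @^-1` U).
  by move=> oU; apply: open_comp => // s _; exact: cl.
exists (l @^-1` ball p0 e); split.
- exact/ol/ball_open.
- by move=> s s01; exact: ball_convex.
split=> [s bs|c' Ac'].
  exact: continuous_comp (cl s) (par_cont (be _ bs)).
pose U := crd c @` (dom c `&` dom c').
have oU : open U by apply: open_crd; exact: dom_open.
have llin : linear (fun s : R => s *: (q - p)).
  by move=> k u v; rewrite scalerDl scalerA.
pose l0 : {linear R -> 'rV[R]_m} := HB.pack (fun s : R => s *: (q - p))
  (GRing.isLinear.Build R R 'rV[R]_m _ _ llin).
have cl0 : continuous l0 by move=> s; exact: scalel_continuous.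
move=> k; apply: (@Ck_on_sub _ _ _ _ _ (l @^-1` U)).
  move=> s [bs ds]; have [d1 d2] := crd_in_dom (be _ bs).
  by exists (par c (l s)).
exact: (@Ck_on_affine _ _ _ _ k U (l @^-1` U) l0 p (crd c' \o par c) (ol _ oU) cl0
  (fun s Us => Us) (At c c' Ac Ac' k)).
Qed.

Lemma path_cat x y z (s s' : seq (R -> T)) :
  path_from_to A x s y -> path_from_to A y s' z -> path_from_to A x (s ++ s') z.
Proof.
elim: s x => [|g s IH] x /=; first by move=> ->.
by move=> [ag gx ps] ps'; split=> //; exact: IH.
Qed.

Lemma path_arcs x y (s : seq (R -> T)) :
  path_from_to A x s y -> {in s, forall g, smooth_arc A g}.
Proof.
elim: s x => [|g s IH] x //= [ag gx ps] h; rewrite inE => /orP[/eqP->//|].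
exact: IH ps _.
Qed.

Lemma path_boundary x y (s : seq (R -> T)) : path_from_to A x s y ->
  forall p : T, \sum_(g <- s) ((g 1 == p)%:R - (g 0 == p)%:R : int) = (y == p)%:R - (x == p)%:R.
Proof.
elim: s x => [|g s IH] x /=; first by move=> -> p; rewrite big_nil subrr.
by move=> [_ g0 /IH H] p; rewrite big_cons H g0 addrC addrA subrK.
Qed.

Lemma int_tau_path_cat (f : T -> cplx R m) s s' :
  int_tau_path f (s ++ s') = int_tau_path f s + int_tau_path f s'.
Proof. exact: big_cat. Qed.

Lemma int_tau_path1 (f : T -> cplx R m) g : int_tau_path f [:: g] = int_tau (f \o g).
Proof. exact: big_seq1. Qed.

Hypothesis T_closed : closed_manifold A.

Let atlas : smooth_atlas A. Proof. by case: T_closed. Qed.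

Lemma chart_ball c p : (crd c @` dom c) p ->
  exists2 e : R, 0 < e & ball p e `<=` crd c @` dom c.
Proof.
move=> Dp; have /nbhs_ballP[e e0 H] : nbhs p (crd c @` dom c).
  by apply: open_nbhs_nbhs; split=> //; exact: crd_open.
by exists e.
Qed.

(** Reachability is constant on coordinate balls, so the reachable set is both
    open and closed. *)
Lemma path_exists x0 x : connected [set: T] -> exists s, path_from_to A x0 s x.
Proof.
move=> Tc; pose B := [set x | exists s, path_from_to A x0 s x].
have nbr y : exists2 N, open N /\ N y & forall z z', N z -> N z' -> B z -> B z'.
  have [c Ac dy] := atlas.1 y.
  have Dy : (crd c @` dom c) (crd c y) by exists y.
  have [e e0 be] := chart_ball Dy.
  exists (dom c `&` crd c @^-1` ball (crd c y) e).
    split; first by apply: open_dom_crd; exact: ball_open.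
    by split=> //; exact: ballxx.
  move=> z z' [dz bz] [dz' bz'] [s ps]; exists (s ++ [:: segment c (crd c z) (crd c z')]).
  apply: path_cat ps _ => /=; rewrite segment0 segment1 !crdK//; split=> //.
  exact: segment_arc atlas Ac be bz bz'.
have oB : open B.
  rewrite openE => y By; have [N [oN Ny] H] := nbr y.
  by apply: filterS (open_nbhs_nbhs (conj oN Ny)) => z Nz; exact: H By.
have cB : closed B.
  rewrite -openC openE => y By; have [N [oN Ny] H] := nbr y.
  by apply: filterS (open_nbhs_nbhs (conj oN Ny)) => z Nz Bz; apply: By; exact: H Bz.
have BT : B = [set: T].
  apply: Tc; first by exists x0, [::].
    by exists B => //; rewrite setTI.
  by exists B => //; rewrite setTI.
by have : B x by rewrite BT.
Qed.

Section Periods.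
Variable f : T -> cplx R m.
Hypothesis f_periods : forall (N : nat) (a : 'I_N -> int) (g : 'I_N -> R -> T),
  smooth_cycle A a g ->
  exists k : int, int_tau_chain f a g = (2 * pi) * k%:~R.

(** Two paths with common end points differ by a cycle. *)
Lemma int_tau_path_mod x y s s' : path_from_to A x s y -> path_from_to A x s' y ->
  exists k : int, int_tau_path f s - int_tau_path f s' = (2 * pi) * k%:~R.
Proof.
move=> ps ps'.
pose l : seq (int * (R -> T)) := [seq (1, g) | g <- s] ++ [seq (-1, g) | g <- s'].
pose a (i : 'I_(size l)) := (tnth (in_tuple l) i).1.
pose g (i : 'I_(size l)) := (tnth (in_tuple l) i).2.
have [|k Hk] := @f_periods (size l) a g.
  split=> [j|p].
    have : tnth (in_tuple l) j \in l by exact: mem_tnth.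
    rewrite /g; case: (tnth _ _) => z h; rewrite mem_cat => /orP[] /mapP[h' h's [_ ->]].
      exact: path_arcs ps _ h's.
    exact: path_arcs ps' _ h's.
  rewrite -(big_tnth _ _ _ xpredT
    (fun q : int * (R -> T) => q.1 * ((q.2 1 == p)%:R - (q.2 0 == p)%:R))).
  rewrite big_cat !big_map /=.
  under eq_bigr do rewrite mul1r.
  under [X in _ + X]eq_bigr do rewrite mulN1r.
  by rewrite sumrN (path_boundary ps) (path_boundary ps') subrr.
exists k; rewrite -Hk /int_tau_chain.
rewrite -(big_tnth _ _ _ xpredT (fun q : int * (R -> T) => q.1%:~R * int_tau (f \o q.2))).
rewrite big_cat !big_map /=.
under eq_bigr do rewrite mul1r.
under [X in _ = _ + X]eq_bigr do rewrite mulN1r.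
by rewrite sumrN.
Qed.

End Periods.
End ChartPaths.

(** * The phase as a local primitive *)

Section Pullback.
Context {R : realType} {m : nat} {V : normedModType R}.
Variables (U : set V) (phi : V -> cplx R m).
Hypothesis oU : open U.
Hypothesis phi_smooth : smooth_on U phi.
Hypothesis phi_isotropic : forall p u v, U p ->
  lambda ('d phi p u) ('d phi p v) = 0.

Let alpha p v := tau (phi p) ('d phi p v).

Lemma pullback_tau_Ck k v : Ck_on k U (alpha ^~ v).
Proof.
apply: Ck_onN => //; apply: Ck_on_lambda => //.
exact: Ck_on_d (phi_smooth k.+1).
Qed.

(** Exterior differentiation of [tau] gives [- 2 omega], which vanishes on the
    image of [phi]; the terms with second derivatives cancel by symmetry. *)
Lemma pullback_tau_closed p u v : U p ->
  'd (alpha ^~ u) p v = 'd (alpha ^~ v) p u.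
Proof.
move=> Up.
have dphi q : U q -> is_diff q phi ('d phi q) by exact: Ck_on_is_diff (phi_smooth 1).
have ddphi w : is_diff p (fun q => 'd phi q w) ('d (fun q => 'd phi q w) p).
  exact: Ck_on_is_diff (Ck_on_d w (phi_smooth 2)) Up.
have dalpha w w' : 'd (alpha ^~ w) p w' = - lambda (phi p) ('d (fun q => 'd phi q w) p w').
  have H := is_diffN (is_diff_lambda (dphi p Up) (ddphi w)).
  have := is_diffE H w'; rewrite !fctE => ->.
  by rewrite phi_isotropic// addr0.
rewrite !dalpha; congr (- _).
pose z := phi p; pose h q := lambda z (phi q).
have hS : Ck_on 2 U h by apply: Ck_on_lambda => //; exact: Ck_on_cst.
have dh q w : U q -> 'd h q w = lambda z ('d phi q w).
  move=> Uq; have H := is_diff_lambda (is_diff_cst z q) (dphi q Uq).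
  by rewrite (is_diffE H) fctE lambda0l addr0.
have ddh w w' : 'd (fun q => 'd h q w) p w' = lambda z ('d (fun q => 'd phi q w) p w').
  have H := is_diff_lambda (is_diff_cst z p) (ddphi w).
  have hE : \forall q \near p, lambda z ('d phi q w) = 'd h q w.
    by apply: filterS (open_nbhs_nbhs (conj oU Up)) => q Uq; rewrite dh.
  have H' := is_diff_near hE H.
  by rewrite (is_diffE H') fctE lambda0l addr0.
by rewrite -!ddh (diff2C u v oU Up hS).
Qed.

End Pullback.

Section Phase.
Context {R : realType}.

Lemma rot_period t (k : int) n (z : cplx R n) : rot (t + 2 * pi * k%:~R) z = rot t z.
Proof.
have P j : rot (t + 2 * pi * j%:R) z = rot t z /\ rot (t - 2 * pi * j%:R) z = rot t z.
  have E : 2 * pi * j%:R = pi *+ 2 *+ j :> R by rewrite mulr_natr mulr_natl.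
  have c := periodicn (@cosD2pi R) j; have s := periodicn (@sinD2pi R) j.
  split; rewrite /Defs.rot E ?c ?s//.
  by rewrite -[in RHS](subrK (pi *+ 2 *+ j) t) c s.
case: k => j; first exact: (P j).1.
by rewrite NegzE mulrNz mulrN; exact: (P j.+1).2.
Qed.

Context {m : nat} {T : topologicalType}.
Variables (A : set (chart R m T)) (f : T -> cplx R m).
Hypothesis T_closed : closed_manifold A.
Hypothesis f_lag : lagrangian_immersion A f.
Hypothesis f_periods : forall (N : nat) (a : 'I_N -> int) (g : 'I_N -> R -> T),
  smooth_cycle A a g ->
  exists k : int, int_tau_chain f a g = (2 * pi) * k%:~R.

Lemma chart_smooth c : A c -> smooth_on (crd c @` dom c) (f \o par c).
Proof. exact: f_lag.1.1. Qed.

Lemma chart_isotropic c p u v : A c -> (crd c @` dom c) p ->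
  lambda ('d (f \o par c) p u) ('d (f \o par c) p v) = 0.
Proof. exact: f_lag.2. Qed.

Lemma int_tau_segment c p0 e p : A c -> ball p0 e `<=` crd c @` dom c ->
  ball p0 e p -> int_tau (f \o segment c p0 p) =
  radial_integral p0 (fun q v => tau ((f \o par c) q) ('d (f \o par c) q v)) p.
Proof.
move=> Ac be bp; apply: eq_Rintegral => s /set_mem /= s01; congr tau.
have Us := be _ (ball_segment bp s01).
have H := is_derive_line (Ck_on_is_diff (chart_smooth Ac 1) Us).
by rewrite derive1E; have [_ <-] := H.
Qed.

Variables (x0 : T) (t : T -> R).
Hypothesis t_phase : path_phase A f x0 t.

Lemma phase_path x y s : path_from_to A x s y ->
  exists k : int, t y = t x + int_tau_path f s + (2 * pi) * k%:~R.
Proof.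
move=> ps; have [sx px tx] := t_phase x; have [sy py ty] := t_phase y.
have [k Hk] := int_tau_path_mod f_periods py (path_cat px ps).
exists k; rewrite -Hk int_tau_path_cat -tx -ty; ring.
Qed.

(** A path to [p], and a path to the centre [p0] followed by the segment to [p],
    form a cycle; so the phase and the integral along segments issued from [p0]
    differ by a constant modulo [2 pi]. *)
Lemma local_phase c p0 : A c -> (crd c @` dom c) p0 ->
  exists (e : R) (F : 'rV[R]_m -> R), [/\ 0 < e, ball p0 e `<=` crd c @` dom c,
    forall p, ball p0 e p ->
      is_diff p F (fun v => tau ((f \o par c) p) ('d (f \o par c) p v))
  & forall p, ball p0 e p -> exists k : int, t (par c p) = F p + (2 * pi) * k%:~R].
Proof.
move=> Ac Dp0; have [e e0 be] := chart_ball Dp0.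
pose a q v := tau ((f \o par c) q) ('d (f \o par c) q v).
have phiS : smooth_on (ball p0 e) (f \o par c).
  by move=> k; exact: Ck_on_sub be (chart_smooth Ac k).
have aC k v : Ck_on k (ball p0 e) (a ^~ v).
  by apply: pullback_tau_Ck => //; exact: ball_open.
have aD q u v h : ball p0 e q -> a q (u + h *: v) = a q u + h * a q v.
  by move=> _; rewrite /a /tau linearD linearZ /= lambdaDr lambdaZr opprD mulrN.
have acl p u v : ball p0 e p -> 'd (a ^~ u) p v = 'd (a ^~ v) p u.
  apply: (pullback_tau_closed _ phiS); first exact: ball_open.
  by move=> q w w' /be; exact: chart_isotropic.
exists e, (fun p => t (par c p0) + radial_integral p0 a p); split=> // p bp.
  have H : is_diff p (radial_integral p0 a) (a p).
    apply: (is_diff_directional (ball_open _ _) bp aD).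
      by move=> v; have := aC 0 v; exact.
    by move=> q v x Uq; exact: (is_derive_radial_integral aD (aC 1) acl).
  apply: is_diff_ext (is_diffD (is_diff_cst (t (par c p0)) p) H) => // v.
  by rewrite !fctE add0r.
have arc : smooth_arc A (segment c p0 p).
  by apply: (segment_arc _ Ac be _ bp); [case: T_closed|exact: ballxx].
have [|k Hk] := @phase_path (par c p0) (par c p) [:: segment c p0 p].
  by rewrite /= segment0 segment1.
by exists k; rewrite Hk int_tau_path1 (int_tau_segment Ac be bp).
Qed.

End Phase.

(** * The Legendrian lift *)

Section Closures.
Context {R : realType} {n : nat} {V : normedModType R}.

Lemma lambda_continuousr (z : cplx R n) : continuous (lambda z).
Proof.
move=> w.
have H : Ck_on 0 [set: cplx R n] (fun w => lambda (cst z w) w).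
  apply: Ck_on_lambda; [exact: openT|exact: Ck_on_cst openT|].
  by move=> y _; exact: cvg_id.
exact: (H w I).
Qed.

Lemma closure_lambda0 (B : set (cplx R n)) z : (forall w, B w -> lambda z w = 0) ->
  forall w, closure B w -> lambda z w = 0.
Proof.
move=> Bz w Bw; apply/eqP; apply/negPn/negP => zw.
have oN : open [set y : R | y != 0] by exact: open_neq.
have [y [By /=]] : B `&` (lambda z @^-1` [set y : R | y != 0]) !=set0.
  apply: Bw; apply: (@lambda_continuousr z w).
  by apply: open_nbhs_nbhs; split.
by rewrite Bz// eqxx.
Qed.

(** Isotropy of the velocities of a parametrisation extends to their limits, and
    so to all tangent vectors. *)
Lemma closure_isotropic (B : set (cplx R n)) :
  (forall u v, B u -> B v -> lambda u v = 0) ->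
  forall u v, closure B u -> closure B v -> lambda u v = 0.
Proof.
move=> BB u v Bu Bv; rewrite lambdaC (closure_lambda0 _ Bu) ?oppr0// => w Bw.
by rewrite lambdaC (closure_lambda0 _ Bv) ?oppr0// => y By; exact: BB.
Qed.

End Closures.

Section Angles.
Context {R : realType}.

Lemma cos_eq1_mod_2pi (r : R) : cos r = 1 -> mod_2pi r = 0.
Proof.
have pi2 : 0 < 2 * pi :> R by rewrite mulr_gt0// pi_gt0.
set y := mod_2pi r => cr.
have y0 : 0 <= y.
  rewrite /y /mod_2pi subr_ge0 mulrC -ler_pdivlMr//; exact/real_floor_le/num_real.
have y2 : y < 2 * pi.
  rewrite /y /mod_2pi ltrBlDr.
  have := real_floorD1_gt (num_real (r / (2 * pi))).
  by rewrite ltr_pdivrMr// intrD mulrDl mul1r addrC [_%:~R * _]mulrC.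
have cy : cos y = 1.
  have := rot_period y (Num.floor (r / (2 * pi))) (const_mx 1, 0 : 'rV[R]_1).
  rewrite /y /mod_2pi subrK => /(congr1 (fun z : cplx R 1 => z.1 ord0 ord0)).
  by rewrite /Defs.rot /= !mxE cr !mulr0 !subr0 !mulr1.
have i0 : (0 : R) \in `[0, pi]%R by rewrite in_itv/= lexx pi_ge0.
have [yp|yp] := leP y pi.
  by apply: cos_inj => //; [rewrite in_itv/= y0|rewrite cos0].
have : 2 * pi - y = 0.
  apply: cos_inj => //; first by rewrite in_itv/=; apply/andP; split; lra.
  by rewrite cos0 addrC mulr_natl cosD2pi cosN cy.
lra.
Qed.

End Angles.

Section Lift.
Context {R : realType} {m : nat} {T : topologicalType}.
Variables (A : set (chart R m T)) (f : T -> cplx R m).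
Hypothesis T_closed : closed_manifold A.
Hypothesis f_ball : forall x, unit_ball (f x).
Hypothesis f_lag : lagrangian_immersion A f.
Hypothesis f_periods : forall (N : nat) (a : 'I_N -> int) (g : 'I_N -> R -> T),
  smooth_cycle A a g ->
  exists k : int, int_tau_chain f a g = (2 * pi) * k%:~R.
Variables (x0 : T) (t : T -> R).
Hypothesis t_phase : path_phase A f x0 t.

Let atlas : smooth_atlas A. Proof. by case: T_closed. Qed.

Let F := lift_of f t.

Let last_coord x := Num.sqrt (1 - normsq (f x)).

Let last_coord_sq x : last_coord x ^+ 2 = 1 - normsq (f x).
Proof. by rewrite sqr_sqrtr// subr_ge0 ltW//; exact: f_ball. Qed.

Let last_coord_gt0 x : 0 < last_coord x.
Proof. by rewrite sqrtr_gt0 subr_gt0; exact: f_ball. Qed.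

Lemma normsq_lift_of x : normsq (F x) = 1.
Proof.
rewrite /F lift_ofE normsq_rot normsq_emb -/(last_coord x) last_coord_sq.
by rewrite expr0n addr0 addrC subrK.
Qed.

(** Near every point of a chart the lift is the local lift built from a smooth
    phase, since changing the phase by a multiple of [2 pi] changes nothing. *)
Let lift_local c p0 : A c -> (crd c @` dom c) p0 ->
  exists (e : R) (P : 'rV[R]_m -> R), [/\ 0 < e, ball p0 e `<=` crd c @` dom c,
    forall p, ball p0 e p ->
      is_diff p P (fun v => tau ((f \o par c) p) ('d (f \o par c) p v))
  & forall p, ball p0 e p -> rot (P p) (emb ((f \o par c) p)
      (Num.sqrt (1 - normsq ((f \o par c) p))) 0) = (F \o par c) p].
Proof.
move=> Ac Dp0; have [e [P [e0 be dP tP]]] := local_phase T_closed f_lag f_periods t_phase Ac Dp0.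
exists e, P; split=> // p bp; have [k tk] := tP p bp.
by rewrite /F /= lift_ofE tk rot_period.
Qed.

Section InChart.
Variable c : chart R m T.
Hypothesis Ac : A c.
Let D := crd c @` dom c.
Let psi := F \o par c.

Lemma chart_lift_smooth : smooth_on D psi.
Proof.
move=> k; apply: Ck_on_local => p Dp.
have [e [P [e0 be dP EP]]] := lift_local Ac Dp.
exists (ball p e); first exact: ballxx.
apply: Ck_on_eq (ball_open _ _) EP _.
apply: lift_smooth (ball_open _ _) _ _ dP k.
  by move=> j; exact: Ck_on_sub be (chart_smooth f_lag Ac j).
by move=> q _; exact: f_ball.
Qed.

Lemma chart_lift_diff p : D p -> is_diff p psi ('d psi p).
Proof. by move=> Dp; exact: Ck_on_is_diff (chart_lift_smooth 1) Dp. Qed.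

Lemma chart_lift_tangent p : D p ->
  [/\ forall v, lambda (psi p) (mulI ('d psi p v)) = 0,
      forall v, lambda (psi p) ('d psi p v) = 0,
      forall u v, lambda ('d psi p u) ('d psi p v) = 0
    & injective ('d psi p)].
Proof.
move=> Dp; have [e [P [e0 be dP EP]]] := lift_local Ac Dp.
have sphi : smooth_on (ball p e) (f \o par c).
  by move=> j; exact: Ck_on_sub be (chart_smooth f_lag Ac j).
have [[_ immf] _] := f_lag.
apply: (lift_tangent (ball_open p e) sphi (fun q _ => f_ball (par c q)) dP EP (ballxx p e0)).
  by move=> u v; exact: (chart_isotropic f_lag u v Ac Dp).
exact: immf.
Qed.

End InChart.

Lemma lift_continuous : continuous F.
Proof.
move=> x; have [c Ac dx] := atlas.1 x.
have Dx : (crd c @` dom c) (crd c x) by exists x.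
have cpsi := differentiable_continuous (is_diff_differentiable (chart_lift_diff Ac Dx)).
have : (F \o par c \o crd c) @ x --> (F \o par c) (crd c x).
  exact: continuous_comp (crd_cont dx) cpsi.
rewrite /= crdK//; apply: cvg_trans; apply: near_eq_cvg.
have : nbhs x (dom c) by apply: open_nbhs_nbhs; split=> //; exact: dom_open.
by apply: filterS => y dy; rewrite /= crdK.
Qed.

Hypothesis f_double : forall (k : nat) (x : 'I_k.+1 -> T),
  injective x -> (forall j, f (x ord0) = f (x j)) ->
  exists2 g : 'I_k -> seq (R -> T),
    (forall j, path_from_to A (x ord0) (g j) (x (lift ord0 j))) &
    let S := [set mod_2pi (int_tau_path f (g j)) | j in [set: 'I_k]] in
    (S #= `I_k)%card /\ ~ S 0.

(** The modulus of the last coordinate of the lift determines [|f|], so equal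
    lifts have the same unit factor and the same image under [f]. At a double
    point of [f] the unit factors differ, because the phases do modulo [2 pi]. *)
Lemma lift_injective : injective F.
Proof.
move=> x y Fxy.
have E : rot (t x - t y) (emb (f x) (last_coord x) 0) = emb (f y) (last_coord y) 0.
  rewrite -[RHS](phase_rotK (t y)) -[X in _ = rot _ X]/(F y) -Fxy.
  by rewrite /F lift_ofE phase_rot_rot addrC.
have /emb_inj[E1 E2 E3] : emb (cos (t x - t y) *: f x + sin (t x - t y) *: mulI (f x))
    (cos (t x - t y) * last_coord x) (sin (t x - t y) * last_coord x)
    = emb (f y) (last_coord y) 0.
  by rewrite -E phase_rotE mulI_emb !embZ embD !mulr0 oppr0 mulr0 addr0 add0r.
have s0 : sin (t x - t y) = 0.
  by apply/eqP; move/eqP: E3; rewrite mulf_eq0 (gt_eqF (last_coord_gt0 x)) orbF.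
have c1 : cos (t x - t y) = 1.
  have := cos2Dsin2 (t x - t y); rewrite s0 expr0n addr0 => /eqP.
  rewrite sqrf_eq1 => /orP[/eqP//|/eqP cN].
  have := last_coord_gt0 y; rewrite -E2 cN mulN1r oppr_gt0.
  by rewrite ltNge (ltW (last_coord_gt0 x)).
have fxy : f x = f y by rewrite -E1 s0 c1 scale1r scale0r addr0.
apply: contrapT => nxy.
(* The condition on double points is applied to the pair formed by [x] and [y]. *)
pose z (i : 'I_2) := if i == ord0 then x else y.
have zinj : injective z.
  move=> i j; rewrite /z; case: ifP => [/eqP->|i0]; case: ifP => [/eqP->|j0] // E'.
    by case: (nxy (esym E')).
  by apply: val_inj; move: i j i0 j0 {E'} => [[|[|i]] hi] [[|[|j]] hj].
have zf j : f (z ord0) = f (z j) by rewrite /z eqxx; case: ifP.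
have [g gp [_ S0]] := f_double zinj zf.
apply: S0; exists ord0 => //.
have pg : path_from_to A x (g ord0) y by exact: gp ord0.
have [k Hk] := phase_path f_periods t_phase pg.
apply: cos_eq1_mod_2pi.
have Et : int_tau_path f (g ord0) = - (t x - t y + 2 * pi * k%:~R) by rewrite Hk; ring.
have := rot_period (t x - t y) k (const_mx 1, 0 : 'rV[R]_1).
move=> /(congr1 (fun z : cplx R 1 => z.1 ord0 ord0)).
by rewrite /Defs.rot /= !mxE Et cosN !mulr0 !subr0 !mulr1 c1.
Qed.

(** A continuous injection of a compact space into a Hausdorff one. *)
Lemma lift_open_image O : open O -> exists2 U, open U & F @` O = range F `&` U.
Proof.
move=> oO; exists (~` (F @` (~` O))).
  rewrite openC; apply: compact_closed; first exact: norm_hausdorff.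
  apply: continuous_compact; first exact/continuous_subspaceT/lift_continuous.
  have [_ _ _ cT] := T_closed.
  by apply: (subclosed_compact _ cT) => //; rewrite closedC.
apply/seteqP; split=> [_ [x Ox <-]|_ [[x _ <-] nx]].
  by split; [exists x|move=> [y nOy /lift_injective yx]; apply: nOy; rewrite yx].
by exists x => //; apply: contrapT => nOx; apply: nx; exists x.
Qed.

Lemma lift_embedding : smooth_embedding A F.
Proof.
split.
- split=> [c Ac|c p Ac Dp]; first exact: chart_lift_smooth.
  by have [] := chart_lift_tangent Ac Dp.
- exact: lift_injective.
- exact: lift_open_image.
Qed.

Lemma chart_lift_open c V' : A c -> open V' -> V' `<=` crd c @` dom c ->
  exists2 U, open U & (F \o par c) @` V' = range F `&` U.
Proof.
move=> Ac oV' V'D; have [U oU HU] := lift_open_image (open_dom_crd c oV').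
exists U => //; rewrite -HU; apply/seteqP; split=> [_ [p V'p <-]|_ [x [dx V'x] <-]].
  by have [d1 d2] := crd_in_dom (V'D _ V'p); exists (par c p) => //; split=> //=; rewrite d2.
by exists (crd c x) => //=; rewrite crdK.
Qed.

Lemma lift_submanifold : embedded_submanifold m (range F).
Proof.
move=> _ [x _ <-]; have [c Ac dx] := atlas.1 x.
have Dx : (crd c @` dom c) (crd c x) by exists x.
exists (crd c @` dom c), (F \o par c); split.
- exact: crd_open.
- exact: chart_lift_smooth.
- by exists (crd c x) => //=; rewrite crdK.
split.
- by move=> p Dp; have [] := chart_lift_tangent Ac Dp.
- move=> p q /set_mem Dp /set_mem Dq /lift_injective E.
  by rewrite -(crd_in_dom Dp).2 -(crd_in_dom Dq).2 E.
- by move=> V'; exact: chart_lift_open.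
Qed.

Lemma lift_legendrian_submanifold : legendrian_submanifold (range F).
Proof.
split; [by move=> _ [x _ <-]; exact: normsq_lift_of|exact: lift_submanifold|].
move=> _ w [x _ <-] tw; have [c Ac dx] := atlas.1 x.
have Dx : (crd c @` dom c) (crd c x) by exists x.
have [_ leg _ inj] := chart_lift_tangent Ac Dx.
have psix : (F \o par c) (crd c x) = F x by rewrite /= crdK.
rewrite -psix in tw leg *.
have cw := tangent_vector_closure (@crd_open _ _ _ c) Dx
  (is_diff_differentiable (chart_lift_diff Ac Dx)) inj
  (fun V' => chart_lift_open Ac (V' := V')) tw.
rewrite /contact_form (closure_lambda0 _ cw) ?mulr0//.
by move=> _ [v _ <-]; exact: leg.
Qed.

End Lift.

(** * The cone over a Legendrian submanifold of the sphere *)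

Section Cone.
Context {R : realType} {m : nat} {T : topologicalType}.
Variables (A : set (chart R m T)) (F : T -> cplx R (m + 1)).
Hypothesis charted : forall x, exists2 c, A c & dom c x.
Hypothesis F_sphere : forall x, normsq (F x) = 1.
Hypothesis F_inj : injective F.
Hypothesis F_open : forall O, open O ->
  exists2 U, open U & F @` O = range F `&` U.
Hypothesis F_smooth : forall c, A c -> smooth_on (crd c @` dom c) (F \o par c).
Hypothesis F_tangent : forall c p, A c -> (crd c @` dom c) p ->
  [/\ forall v, lambda ((F \o par c) p) (mulI ('d (F \o par c) p v)) = 0,
      forall v, lambda ((F \o par c) p) ('d (F \o par c) p v) = 0,
      forall u v, lambda ('d (F \o par c) p u) ('d (F \o par c) p v) = 0
    & injective ('d (F \o par c) p)].

Let S := cone (range F).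

Let radius (u : 'rV[R]_(m + 1)) : R := u ord0 (rshift m ord0).

Let radius_linear : linear radius.
Proof. by move=> a u v; rewrite /radius !mxE. Qed.

Let radiusL : {linear 'rV[R]_(m + 1) -> R} :=
  HB.pack radius (GRing.isLinear.Build R 'rV[R]_(m + 1) R _ radius radius_linear).

Let base : {linear 'rV[R]_(m + 1) -> 'rV[R]_m} := lsubmx.

Let base_continuous : continuous base. Proof. exact: linear_row_continuous. Qed.

Let radius_continuous : continuous radius.
Proof. exact: (@linear_row_continuous R (m + 1) R radiusL). Qed.

Let polar (p : 'rV[R]_m) (r : R) : 'rV[R]_(m + 1) := row_mx p (const_mx r).

Let base_polar p r : base (polar p r) = p. Proof. exact: row_mxKl. Qed.

Let radius_polar p r : radius (polar p r) = r.
Proof. by rewrite /radius row_mxEr mxE. Qed.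

Let polarK u : polar (base u) (radius u) = u.
Proof.
rewrite -[RHS]hsubmxK; congr row_mx; apply/matrixP => i j.
by rewrite !mxE (ord1 i) (ord1 j).
Qed.

Let polar_continuous : continuous (fun z : 'rV[R]_m * R => polar z.1 z.2).
Proof.
have E (z : 'rV[R]_m * R) : polar z.1 z.2 = (emb0 (z.1, 0)).1 + z.2 *: polar 0 1.
  rewrite /polar /emb0 /emb /= scale_row_mx add_row_mx scaler0 addr0; congr row_mx.
  by apply/matrixP => i j; rewrite !mxE add0r mulr1.
pose g (z : 'rV[R]_m * R) : cplx R m := (z.1, 0).
have cg : continuous g.
  move=> z; apply: (@cvg_pair _ _ _ (nbhs z) (nbhs z.1) (nbhs (0 : 'rV[R]_m))).
    exact: cvg_fst.
  exact: cvg_cst.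
rewrite (funext E) => z; apply: cvgD; last by apply: cvgZr_tmp; exact: cvg_snd.
have H := continuous_comp (cg z) (@emb0_continuous R m (g z)).
exact: (continuous_comp H cvg_fst).
Qed.

Section InChart.
Variable c : chart R m T.
Hypothesis Ac : A c.
Let D := crd c @` dom c.
Let psi := F \o par c.
Let V := [set u | 0 < radius u /\ D (base u)].
Let Psi u := radius u *: psi (base u).

Lemma cone_chart_open : open V.
Proof.
apply: openI.
  apply: (open_comp (D := [set r : R | 0 < r])); last exact: open_gt.
  by move=> u _; exact: radius_continuous.
apply: (open_comp (D := D)); last exact: crd_open.
by move=> u _; exact: base_continuous.
Qed.

Lemma cone_chart_smooth : smooth_on V Psi.
Proof.
move=> k; apply: Ck_onZ; first exact: cone_chart_open.
  exact: (Ck_on_linear (L := radiusL) k cone_chart_open radius_continuous).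
apply: (Ck_on_eq cone_chart_open (f := fun u => psi (0 + base u))).
  by move=> u _; rewrite add0r.
apply: (Ck_on_affine cone_chart_open base_continuous _ (F_smooth Ac k)).
by move=> u [_ Du]; rewrite add0r.
Qed.

Lemma cone_chart_diff u : V u -> is_diff u Psi
  (fun h => radius u *: 'd psi (base u) (base h) + radius h *: psi (base u)).
Proof.
move=> [_ Du]; have dr := is_diff_linear (L := radiusL) u radius_continuous.
have dpsi := Ck_on_is_diff (F_smooth Ac 1) Du.
have db := is_diff_linear (L := base) u base_continuous.
exact: is_diff_scale dr (@is_diff_comp _ _ _ _ _ _ _ _ _ db dpsi).
Qed.

Lemma cone_chart_isotropic u h k : V u -> lambda ('d Psi u h) ('d Psi u k) = 0.
Proof.
move=> Vu; have dE := is_diffE (cone_chart_diff Vu).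
have [_ leg iso _] := F_tangent Ac Vu.2.
have leg' v : lambda ('d psi (base u) v) (psi (base u)) = 0 by rewrite lambdaC leg oppr0.
rewrite [X in lambda X _]dE [X in lambda _ X]dE.
rewrite !(lambdaDl, lambdaDr, lambdaZl, lambdaZr) iso leg leg' lambdaxx.
by ring.
Qed.

(** The radial component of the velocity is recovered by projection to the
    position vector, to which the sphere is orthogonal. *)
Lemma cone_chart_immersive u : V u -> injective ('d Psi u).
Proof.
move=> Vu h k; have dE := is_diffE (cone_chart_diff Vu).
have [orth _ _ inj] := F_tangent Ac Vu.2.
have [ru Du] := Vu.
rewrite [LHS]dE [RHS]dE => E.
have L w : lambda (psi (base u)) (mulI (radius u *: 'd psi (base u) (base w) +
    radius w *: psi (base u))) = radius w.
  rewrite lambda_mulIC lambdaDl !lambdaZl -normsqE F_sphere mulr1.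
  by rewrite lambda_mulIC orth mulr0 add0r.
have rE : radius h = radius k by rewrite -L E L.
move: E; rewrite rE => /addIr /(scalerI (lt0r_neq0 ru)) /inj bE.
by rewrite -(polarK h) -(polarK k) bE rE.
Qed.

Let radial_inj r r' x x' : 0 < r -> 0 < r' -> r *: F x = r' *: F x' ->
  r = r' /\ x = x'.
Proof.
move=> r0 r'0 E; have rE : r = r'.
  have := congr1 (@normsq R (m + 1)) E; rewrite !normsqZ !F_sphere !mulr1.
  by move/eqP; rewrite eqrXn2 ?ltW// => /eqP.
by split=> //; apply: F_inj; move: E; rewrite rE => /(scalerI (lt0r_neq0 r'0)).
Qed.

Lemma cone_chart_injective : {in V &, injective Psi}.
Proof.
move=> u v /set_mem[ru Du] /set_mem[rv Dv] /(radial_inj ru rv)[rE pE].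
by rewrite -(polarK u) -(polarK v) rE -(crd_in_dom Du).2 -(crd_in_dom Dv).2 pE.
Qed.

Let enorm (z : cplx R (m + 1)) : R := Num.sqrt (normsq z).

Let enorm_continuous : continuous enorm.
Proof.
move=> z; apply: (@continuous_comp _ _ _ (@normsq R (m + 1)) Num.sqrt).
  have H : Ck_on 0 [set: cplx R (m + 1)] (fun w => lambda w (mulI w)).
    apply: Ck_on_lambda; [exact: openT|by move=> y _; exact: cvg_id|].
    by move=> y _; exact: mulI_continuous.
  rewrite (_ : @normsq R (m + 1) = fun w => lambda w (mulI w)); first exact: (H z I).
  by apply/funext => w; rewrite normsqE.
exact: sqrt_continuous.
Qed.

Let enorm_radial r x : 0 < r -> enorm (r *: F x) = r.
Proof. by move=> r0; rewrite /enorm normsqZ F_sphere mulr1 sqrtr_sqr gtr0_norm. Qed.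

(** A point of the cone close to [Psi u] has its radius close to [radius u] and
    its projection to the sphere close to [psi (base u)]. *)
Lemma cone_chart_image V' : open V' -> V' `<=` V ->
  exists2 U, open U & Psi @` V' = S `&` U.
Proof.
move=> oV' V'V.
have nb u : V' u -> exists U, [/\ open U, U (Psi u) & S `&` U `<=` Psi @` V'].
  move=> V'u; have [ru Du] := V'V _ V'u.
  have : nbhs (base u, radius u) [set z | V' (polar z.1 z.2)].
    apply: (polar_continuous (x := (base u, radius u))).
    by apply: open_nbhs_nbhs; split=> //=; rewrite polarK.
  move=> /nbhs_ballP[e /= e0 He].
  have [UF oUF HUF] := F_open (open_dom_crd c (ball_open (base u) e)).
  pose N := [set z | 0 < enorm z /\ `|radius u - enorm z| < e].
  have oN : open N.
    apply: (open_comp (f := enorm) (D := [set r : R | 0 < r /\ `|radius u - r| < e])).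
      by move=> z _; exact: enorm_continuous.
    apply: openI; first exact: open_gt.
    by have := ball_open (radius u) e; rewrite -ball_normE.
  exists (N `&` [set z | UF ((enorm z)^-1 *: z)]); split.
  - rewrite openE => z [Nz Uz]; apply: filterI; first exact: open_nbhs_nbhs.
    have cz : {for z, continuous (fun z => (enorm z)^-1 *: z)}.
      apply: cvgZ; last exact: cvg_id.
      by apply: cvgV; [rewrite gt_eqF//; exact: Nz.1|exact: enorm_continuous].
    by apply: cz; exact: open_nbhs_nbhs.
  - rewrite /Psi /N; split=> /=; rewrite enorm_radial//.
      by split=> //; rewrite subrr normr0.
    rewrite scalerA mulVf ?gt_eqF// scale1r.
    have : (F @` (dom c `&` crd c @^-1` ball (base u) e)) (psi (base u)).
      have [d1 d2] := crd_in_dom Du; exists (par c (base u)) => //.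
      by split=> //=; rewrite d2; exact: ballxx.
    by rewrite HUF => -[].
  - move=> _ [[r [_ [r0 [x _ <-] ->]]] [[_ /= +] /= +]].
    rewrite enorm_radial// scalerA mulVf ?gt_eqF// scale1r => re UFx.
    have : (range F `&` UF) (F x) by split=> //; exists x.
    rewrite -HUF => -[y [dy by_] /F_inj yx].
    exists (polar (crd c y) r); first exact: (He (crd c y, r)).
    by rewrite /Psi radius_polar base_polar /psi /= crdK// yx.
exists (\bigcup_(U in [set U | open U /\ S `&` U `<=` Psi @` V']) U).
  by apply: bigcup_open => U [].
apply/seteqP; split=> [_ [u V'u <-]|z [Sz [U [_ SU] Uz]]]; last by apply: SU.
have [U [oU Uu SU]] := nb u V'u; split; last by exists U.
exists (radius u), (psi (base u)).
by split; [exact: (V'V _ V'u).1|exists (par c (base u))|].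
Qed.

End InChart.

Lemma cone_submanifold : embedded_submanifold (m + 1) S.
Proof.
move=> _ [r [_ [r0 [x _ <-] ->]]]; have [c Ac dx] := charted x.
exists [set u | 0 < radius u /\ (crd c @` dom c) (base u)].
exists (fun u => radius u *: (F \o par c) (base u)); split.
- exact: cone_chart_open.
- exact: cone_chart_smooth.
- exists (polar (crd c x) r); last by rewrite radius_polar base_polar /= crdK.
  by split; rewrite ?radius_polar ?base_polar//; exists x.
split.
- by move=> u Vu; exact: cone_chart_immersive.
- exact: cone_chart_injective.
- by move=> V'; exact: cone_chart_image.
Qed.

Lemma cone_lagrangian : lagrangian_submanifold S.
Proof.
split; first exact: cone_submanifold.
move=> _ v w [r [_ [r0 [x _ <-] ->]]]; have [c Ac dx] := charted x.
pose V := [set u | 0 < radius u /\ (crd c @` dom c) (base u)].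
pose Psi u := radius u *: (F \o par c) (base u).
pose u := polar (crd c x) r.
have Vu : V u by split; rewrite ?radius_polar ?base_polar//; exists x.
have uE : Psi u = r *: F x by rewrite /Psi radius_polar base_polar /= crdK.
rewrite -uE => tv tw.
have cl y : tangent_vector S (Psi u) y -> closure (range ('d Psi u)) y.
  exact: (tangent_vector_closure (@cone_chart_open c) Vu
    (is_diff_differentiable (cone_chart_diff Ac Vu)) (cone_chart_immersive Ac Vu)
    (fun V' => @cone_chart_image c V')).
apply: closure_isotropic (cl _ tv) (cl _ tw).
by move=> _ _ [h _ <-] [k _ <-]; exact: cone_chart_isotropic.
Qed.

End Cone.

Theorem theorem3p2 (R : realType) (m : nat) (T : topologicalType)
    (A : set (chart R m T)) (f : T -> cplx R m)
    (T_closed : closed_manifold A)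
    (T_conn : connected [set: T])
    (f_ball : forall x, unit_ball (f x))
    (f_lag : lagrangian_immersion A f)
    (f_periods : forall (N : nat) (a : 'I_N -> int) (g : 'I_N -> R -> T),
      smooth_cycle A a g ->
      exists k : int, int_tau_chain f a g = (2 * pi) * k%:~R)
    (f_double : forall (k : nat) (x : 'I_k.+1 -> T),
      injective x -> (forall j, f (x ord0) = f (x j)) ->
      exists2 g : 'I_k -> seq (R -> T),
        (forall j, path_from_to A (x ord0) (g j) (x (lift ord0 j))) &
        let S := [set mod_2pi (int_tau_path f (g j)) | j in [set: 'I_k]] in
        (S #= `I_k)%card /\ ~ S 0)
    (x0 : T) :
  (exists t, path_phase A f x0 t) /\
  (forall t, path_phase A f x0 t ->
    [/\ smooth_embedding A (lift_of f t),
        legendrian_submanifold (range (lift_of f t))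
      & lagrangian_submanifold (cone (range (lift_of f t)))]).
Proof.
split.
  have [s ps] := choice (fun x => path_exists T_closed x0 x T_conn).
  by exists (fun x => int_tau_path f (s x)) => x; exists (s x).
move=> t t_phase.
have emb_t := lift_embedding T_closed f_ball f_lag f_periods t_phase f_double.
split=> //; first exact: lift_legendrian_submanifold t_phase f_double.
have [_ t_inj t_open] := emb_t.
apply: (@cone_lagrangian _ _ _ A) => //.
- by case: T_closed => -[].
- by move=> x; exact: normsq_lift_of f_ball t x.
- by move=> c Ac; exact: chart_lift_smooth T_closed f_ball f_lag f_periods _ _ t_phase _ Ac.
- by move=> c p Ac Dp; exact: chart_lift_tangent t_phase _ Ac _ Dp.
Qed.
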